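(* Let $p$ be a positive constant with $p\le 1/2$, let $b=1/p$, let $c$ and $\epsilon$ be positive constants, and let $G\in G(n,p)$. Then asymptotically almost surely (as $n\to\infty$), for all vertex subsets $U\subseteq V(G)$ with $|U|\ge c(\log_b n)^{3+\epsilon}$, we have $$\tau'(G[U])\ \ge\ 1.0001\,|U| .$$
   Context: $G(n,p)$ denotes the random graph on $n$ labelled vertices in which each pair of vertices is an edge independently with probability $p$. ''Asymptotically almost surely'' means with probability tending to $1$ as $n\to\infty$. $G[U]$ is the subgraph of $G$ induced by $U$. A star is a complete bipartite graph in which all edges share a common vertex. The strong bipartition number $\tau'(H)$ of a graph $H$ is the minimum number of complete bipartite subgraphs of $H$, none of which is a star, that are pairwise edge-disjoint and whose union is the edge set of $H$; if no such partition exists then $\tau'(H)=\infty$, and if $|V(H)|\le 2$ then $\tau'(H)$ is defined to be $0$. *)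

(* Defs.v *)
From mathcomp Require Import all_boot all_order all_algebra.
From mathcomp Require Import all_classical all_reals all_analysis.

Set Implicit Arguments.
Unset Strict Implicit.
Unset Printing Implicit Defensive.

Import Order.TTheory GRing.Theory Num.Theory.
Import numFieldNormedType.Exports.

Local Open Scope ring_scope.

(* A simple graph is given by its vertex set V : {set T} and its edge set
   E : {set {set T}}, a set of 2-element subsets of V. *)

Definition vertex_pairs (T : finType) (V : {set T}) : {set {set T}} :=
  [set e : {set T} | (e \subset V) && (#|e| == 2)]%SET.

(* Edge set of G[U], when E is the edge set of G. *)
Definition induced_edges (T : finType) (E : {set {set T}}) (U : {set T}) :
    {set {set T}} :=
  [set e in E | e \subset U]%SET.

(* Complete bipartite subgraphs have nonempty parts, hence no isolated
   vertices, so they are identified with their edge sets. *)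
Definition complete_bipartite (T : finType) (F : {set {set T}}) : bool :=
  [exists A : {set T}, [exists B : {set T},
    [&& A != finset.set0, B != finset.set0, [disjoint A & B] &
        F == [set [set x; y] | x in A, y in B]%SET]]].

Definition is_star (T : finType) (F : {set {set T}}) : bool :=
  complete_bipartite F && [exists v : T, [forall e in F, v \in e]].

Definition strong_bipartition (T : finType) (E : {set {set T}})
    (P : {set {set {set T}}}) : bool :=
  finset.partition P E && [forall F in P, complete_bipartite F && ~~ is_star F].

(* The infimum of the empty set is +oo, and that of a nonempty set of
   natural numbers is its minimum. *)
Definition tau' (R : realType) (T : finType) (V : {set T})
    (E : {set {set T}}) : \bar R :=
  if (#|V| <= 2)%N then 0%E
  else ereal_inf [set (#|P|%:R)%:E | P in [set P | strong_bipartition E P]]%classic.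

(* G(n, p): the outcomes are the edge sets on 'I_n, and the probability of an
   outcome is the product of the probabilities of its edges and non-edges. *)
Definition Gnp_weight (R : realType) (n : nat) (p : R)
    (E : {set {set 'I_n}}) : R :=
  \prod_(e in vertex_pairs [set: 'I_n]%SET) (if e \in E then p else 1 - p).

Definition Gnp_prob (R : realType) (n : nat) (p : R)
    (A : pred {set {set 'I_n}}) : R :=
  \sum_(E : {set {set 'I_n}} | (E \subset vertex_pairs [set: 'I_n]%SET) && A E)
     Gnp_weight p E.

Definition logb (R : realType) (b x : R) : R := ln x / ln b.

Definition aas (R : realType) (p : R)
    (A : forall n : nat, pred {set {set 'I_n}}) : Prop :=
  ((fun n : nat => Gnp_prob p (A n)) @ \oo --> (1 : R))%classic.

(* Main.v *)
Require Import Defs.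
From mathcomp Require Import all_boot all_order all_algebra.
From mathcomp Require Import all_classical all_reals all_analysis.
From mathcomp Require Import fintype finset ring lra zify.
Import Order.TTheory GRing.Theory Num.Theory.
Import numFieldNormedType.Exports.
Local Open Scope ring_scope.

(* Let m = |U| and suppose that the edges of G[U] are split into at most 2m
   bicliques with sides A_i and B_i, where 2 <= |A_i| <= |B_i|.

   For a fixed family of bounded sets A_i in which every vertex has bounded
   degree, an edge xy is covered only if some A_i containing x (and not y) lies
   in N(y), or conversely.  By Harris' inequality xy is an uncovered edge with
   probability at least p times the product of the factors 1 - p^(|A_i| - 1)
   over all A_i containing x or y, which on average over x and y is bounded
   below, independently of the sizes of the A_i.  So the expected number of
   uncovered edges is at least of order m^2.  This number is a Lipschitz function
   of the edges, so it is at most half its mean with probability exp(-c m^2).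

   The remaining bicliques cover few edges.  If |B_i| is bounded, this is clear.
   If |A_i| > L and |B_i| >= L, the bound p^(sum |A_i||B_i|) on the probability that
   given edge-disjoint bicliques are present beats the number of choices, as the
   sum of p^(|A||B|/2) over all such A, B in U is exp(O(m p^(L/4))).  If A_i is
   small and meets the set W of vertices of large degree in the family, each edge
   at W belongs to one biclique, so these bicliques cover at most L|W|m edges.

   There are exp(O(m log n)) choices of U and of the small sets A_i, which is
   negligible against exp(c m^2) because m is much larger than log n. *)

Set Implicit Arguments.
Unset Strict Implicit.
Unset Printing Implicit Defensive.

(** * Random subsets *)

Section RandomSubset.
Local Open Scope set_scope.
Variables (R : realType) (T : finType) (p : R).
Implicit Types (D E F : {set T}) (e : T) (f g : {set T} -> R).

Definition subset_weight D E : R := \prod_(e in D) (if e \in E then p else 1 - p).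

(** Expectation of [f E] when [E] contains each element of [D] independently with probability
    [p]. *)
Definition subset_mean D f : R :=
  \sum_(E : {set T} | E \subset D) subset_weight D E * f E.

Lemma eq_subset_mean D f g :
  (forall E, E \subset D -> f E = g E) -> subset_mean D f = subset_mean D g.
Proof. by move=> fg; apply: eq_bigr => E /fg ->. Qed.

Lemma subset_mean0 f : subset_mean set0 f = f set0.
Proof.
rewrite /subset_mean (big_pred1 set0) => [|E]; last by rewrite subset0.
by rewrite /subset_weight big_set0 mul1r.
Qed.

(** Conditioning on whether [e] is chosen: the sets containing [e] are reindexed by removing it.
    This is the inductive step for the main facts on means. *)
Lemma subset_meanU1 e D f : e \notin D ->
  subset_mean (e |: D) f =
  p * subset_mean D (fun E => f (e |: E)) + (1 - p) * subset_mean D f.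
Proof.
move=> eD; rewrite /subset_mean (bigID (fun E : {set T} => e \in E)) /=.
congr (_ + _).
- rewrite (reindex_onto (fun E => e |: E) (fun E => E :\ e)) /=; last first.
    by move=> E /andP[_ eE]; rewrite setD1K.
  rewrite big_distrr /=; apply: eq_big => [E|E ED].
    apply/idP/idP.
      move=> /andP[/andP[ED _] /eqP eqE]; rewrite -eqE.
      by rewrite subDset.
    move=> ED; rewrite setUS // setU11 /= setU1K //.
    by apply: contra eD; exact: (subsetP ED).
  have {}ED : E \subset D.
    move: ED => /andP[/andP[ED _] /eqP eqE]; rewrite -eqE.
    by rewrite subDset.
  rewrite /subset_weight big_setU1 //= setU11 mulrA; congr (_ * _ * _).
  apply: eq_bigr => x xD; rewrite in_setU1; case: eqP => // xe.
  by rewrite xe (negbTE eD) in xD.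
rewrite big_distrr /=; apply: eq_big => [E|E].
  rewrite -subsetD1 setU1K //.
rewrite -subsetD1 setU1K // => ED.
rewrite /subset_weight big_setU1 //= ifN ?mulrA //.
by apply: contra eD; exact: (subsetP ED).
Qed.

Lemma subset_meanD D f g :
  subset_mean D (fun E => f E + g E) = subset_mean D f + subset_mean D g.
Proof. by rewrite -big_split; apply: eq_bigr => E _; rewrite mulrDr. Qed.

Lemma subset_meanZ D a f : subset_mean D (fun E => a * f E) = a * subset_mean D f.
Proof. by rewrite big_distrr; apply: eq_bigr => E _; rewrite mulrCA. Qed.

Lemma subset_mean_sum (I : finType) (P : pred I) D (F : I -> {set T} -> R) :
  subset_mean D (fun E => \sum_(i | P i) F i E) =
  \sum_(i | P i) subset_mean D (F i).
Proof.
rewrite exchange_big; apply: eq_bigr => E _.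
by rewrite big_distrr.
Qed.

Lemma set_split D e : e \in D -> D = e |: (D :\ e) /\ e \notin D :\ e.
Proof. by move=> eD; rewrite setD1K ?setD11. Qed.

Lemma set1U_ind (P : {set T} -> Prop) :
  P set0 -> (forall e D, e \notin D -> P D -> P (e |: D)) -> forall D, P D.
Proof.
move=> P0 PU D; have [n] := ubnP #|D|; elim: n D => // n IHn D Dn.
have [->//|/set0Pn[e eD]] := eqVneq D set0.
have [De neD] := set_split eD; rewrite De; apply: PU neD (IHn _ _).
by move: Dn; rewrite (cardsD1 e) eD.
Qed.

Lemma subset_mean_cst D a : subset_mean D (fun=> a) = a.
Proof.
elim/set1U_ind: D => [|e D eD IH]; first exact: subset_mean0.
by rewrite subset_meanU1 // IH; ring.
Qed.

(** Independence: [f] ignores [e], and [e] is chosen with probability [p]. *)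
Lemma subset_mean_mem e D f : e \in D ->
  (forall E, f (e |: E) = f E) ->
  subset_mean D (fun E => (e \in E)%:R * f E) = p * subset_mean D f.
Proof.
move=> /set_split[De neD] fe; rewrite De !subset_meanU1 //.
have -> : subset_mean (D :\ e) (fun E => (e \in e |: E)%:R * f (e |: E)) =
          subset_mean (D :\ e) f.
  by apply: eq_subset_mean => E _; rewrite setU11 mul1r fe.
have -> : subset_mean (D :\ e) (fun E => (e \in E)%:R * f E) =
          subset_mean (D :\ e) (fun=> 0).
  apply: eq_subset_mean => E /subsetP ED.
  have /negbTE-> : e \notin E by apply: contra neD => /ED.
  by rewrite mulr0n mul0r.
have -> : subset_mean (D :\ e) (fun E => f (e |: E)) = subset_mean (D :\ e) f.
  by apply: eq_subset_mean => E _.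
by rewrite subset_mean_cst; ring.
Qed.

Lemma subset_mean_sub F D : F \subset D ->
  subset_mean D (fun E => (F \subset E)%:R) = p ^+ #|F|.
Proof.
elim/set1U_ind: F => [|e F eF IH].
  move=> _; rewrite cards0 expr0 -[RHS](subset_mean_cst D 1).
  by apply: eq_subset_mean => E _; rewrite sub0set.
rewrite subUset sub1set => /andP[eD FD].
rewrite cardsU1 eF exprS -IH // -(subset_mean_mem eD) => [|E].
  apply: eq_subset_mean => E _.
  by rewrite subUset sub1set; case: (e \in E); rewrite ?mulr0n ?mul1r ?mul0r.
congr (_%:R); rewrite -{1}(setU1K eF) subDset.
by rewrite setUA setUid -subDset setU1K.
Qed.

Hypotheses (p_ge0 : 0 <= p) (p_le1 : p <= 1).

Lemma subset_weight_ge0 D E : 0 <= subset_weight D E.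
Proof. by apply: prodr_ge0 => e _; case: ifP => // _; rewrite subr_ge0. Qed.

Lemma le_subset_mean D f g :
  (forall E, E \subset D -> f E <= g E) -> subset_mean D f <= subset_mean D g.
Proof.
by move=> fg; apply: ler_sum => E /fg fgE; exact: ler_wpM2l (subset_weight_ge0 _ _) _ _ fgE.
Qed.

Lemma subset_mean_ge0 D f : (forall E, 0 <= f E) -> 0 <= subset_mean D f.
Proof. by move=> f0; rewrite -[0](subset_mean_cst D); apply: le_subset_mean. Qed.

Definition antitone f := forall E E', E \subset E' -> f E' <= f E.

(** Harris' inequality, by induction on [D]: given the choice at [e], the functions stay antitone,
    and their two conditional means are ordered the same way. *)
Lemma subset_mean_harris D f g : antitone f -> antitone g ->
  subset_mean D f * subset_mean D g <= subset_mean D (fun E => f E * g E).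
Proof.
elim/set1U_ind: D f g => [|e D eD IH] f g af ag; first by rewrite !subset_mean0.
rewrite !subset_meanU1 //.
have anti h : antitone h -> antitone (fun E => h (e |: E)).
  by move=> ah E E' EE'; apply: ah; rewrite setUS.
have := IH _ _ af ag; have := IH _ _ (anti _ af) (anti _ ag).
have le h : antitone h -> subset_mean D (fun E => h (e |: E)) <= subset_mean D h.
  by move=> ah; apply: le_subset_mean => E _; apply: ah; rewrite subsetUr.
have := le _ af; have := le _ ag => {le anti IH}.
set a1 := subset_mean D _; set a0 := subset_mean D _ => le_a.
set b1 := subset_mean D _; set b0 := subset_mean D _ => le_b.
set c1 := subset_mean D _; set c0 := subset_mean D _ => h1 h0.
(* This is the excess of [p * (b1 * a1) + (1 - p) * (b0 * a0)] over the product of the two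
   averages. *)
have : 0 <= p * (1 - p) * ((b0 - b1) * (a0 - a1)).
  by rewrite !mulr_ge0 ?subr_ge0.
have : p * (b1 * a1) <= p * c1 by exact: ler_wpM2l.
have : (1 - p) * (b0 * a0) <= (1 - p) * c0 by apply: ler_wpM2l; rewrite ?subr_ge0.
nra.
Qed.

Lemma antitone_nsub F : antitone (fun E => (~~ (F \subset E))%:R).
Proof.
move=> E E' EE'; rewrite ler_nat; case: (boolP (F \subset E)) => /= FE; last exact: leq_b1.
by rewrite (subset_trans FE EE').
Qed.

(** Each event that [F i] is not contained in [E] is decreasing in [E], so Harris' inequality
    applies one index at a time, even if the [F i] overlap. *)
Lemma subset_mean_nsub (I : finType) (P : pred I) (F : I -> {set T}) D :
  (forall i, P i -> F i \subset D) ->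
  \prod_(i | P i) (1 - p ^+ #|F i|) <=
  subset_mean D (fun E => \prod_(i | P i) (~~ (F i \subset E))%:R).
Proof.
move=> FD; rewrite -big_filter.
have -> : subset_mean D (fun E => \prod_(i | P i) (~~ (F i \subset E))%:R) =
  subset_mean D (fun E => \prod_(i <- [seq i <- index_enum I | P i])
     (~~ (F i \subset E))%:R).
  by apply: eq_subset_mean => E _; rewrite big_filter.
have : all P [seq i <- index_enum I | P i] by exact: filter_all.
elim: [seq _ <- _ | _] => [|i s IH] /=.
  move=> _; rewrite big_nil -[leLHS](subset_mean_cst D).
  by apply: le_subset_mean => E _; rewrite big_nil.
move=> /andP[Pi /IH{}IH].
pose h E : R := \prod_(j <- s) (~~ (F j \subset E))%:R.
have -> : subset_mean D (fun E => \prod_(j <- i :: s) (~~ (F j \subset E))%:R) =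
  subset_mean D (fun E => (~~ (F i \subset E))%:R * h E).
  by apply: eq_subset_mean => E _; rewrite big_cons.
apply: le_trans (subset_mean_harris _ (antitone_nsub _) _); last first.
  move=> E E' EE'; rewrite /h !big_seq; apply: ler_prod => j _.
  by rewrite ler0n antitone_nsub.
have -> : subset_mean D (fun E => (~~ (F i \subset E))%:R) = 1 - p ^+ #|F i|.
  rewrite -(subset_mean_sub (FD _ Pi)).
  transitivity (subset_mean D (fun E => 1 + -1 * (F i \subset E)%:R)).
    by apply: eq_subset_mean => E _; case: (F i \subset E) => /=; ring.
  by rewrite subset_meanD subset_meanZ subset_mean_cst mulN1r.
rewrite big_cons; apply: ler_wpM2l => //.
by rewrite subr_ge0 exprn_ile1.
Qed.

Lemma expR_le_quadratic (x : R) : x <= 1 / 2 -> expR x <= 1 + x + 2 * x ^+ 2.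
Proof.
move=> x2; rewrite -[x in expR x]opprK expRN -[leLHS]mul1r.
rewrite ler_pdivrMr ?expR_gt0 //.
have q0 : 0 <= 1 + x + 2 * x ^+ 2 by have := sqr_ge0 (x + 1 / 4); nra.
apply: le_trans (ler_wpM2l q0 (expR_ge1Dx (- x))).
(* As exp(-x) is at least 1 - x, it suffices that (1 + x + 2x^2)(1 - x) is at least 1; the
   difference is x^2 (1 - 2x). *)
have : 0 <= x ^+ 2 * (1 - 2 * x) by rewrite mulr_ge0 ?sqr_ge0 //; lra.
by rewrite -subr_ge0 => h; rewrite (_ : _ - _ = x ^+ 2 * (1 - 2 * x)) //; ring.
Qed.

(** Exponential moment for the lower tail, revealing one element at a time. Averaging over [e] turns
    [f] into [h], with the same mean and Lipschitz constants, at the cost of a factor at most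
    [1 + 2 * lam ^+ 2 * c e ^+ 2]. *)
Lemma subset_mean_lipschitz D f (c : T -> R) (lam : R) : 0 <= lam ->
  (forall e E, e \in D -> `|f (e |: E) - f E| <= c e) ->
  (forall e, e \in D -> lam * c e <= 1 / 2) ->
  subset_mean D (fun E => expR (lam * (subset_mean D f - f E))) <=
  expR (2 * lam ^+ 2 * \sum_(e in D) c e ^+ 2).
Proof.
move=> lam0; move: (p_ge0) (p_le1) => p0 p1.
elim/set1U_ind: D f => [|e D eD IH] f lip lamc.
  by rewrite !subset_mean0 big_set0 subrr !mulr0.
rewrite subset_meanU1 // [in leRHS]big_setU1 //=.
pose h E := p * f (e |: E) + (1 - p) * f E.
have hlip e' E : e' \in D -> `|h (e' |: E) - h E| <= c e'.
  move=> e'D; have De' : e' \in e |: D by rewrite setU1r.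
  have := lip e' (e |: E) De'; rewrite setUCA; have := lip e' E De'.
  rewrite /h; set a := f _; set b := f _; set a' := f _; set b' := f _ => h1 h2.
  have -> : p * a' + (1 - p) * a - (p * b' + (1 - p) * b) =
            p * (a' - b') + (1 - p) * (a - b) by ring.
  apply: le_trans (ler_normD _ _) _; rewrite !normrM (ger0_norm p_ge0).
  rewrite (@ger0_norm _ (1 - p)) ?subr_ge0 //.
  have := ler_wpM2l p_ge0 h2; have := ler_wpM2l _ h1 => /(_ (1 - p)).
  rewrite subr_ge0 => /(_ p_le1); lra.
have Mh : subset_mean D h = subset_mean (e |: D) f.
  by rewrite subset_meanU1 // -!subset_meanZ -subset_meanD.
have {}IH := IH h hlip (fun e' H => lamc e' (setU1r e H)).
rewrite -!Mh -!subset_meanZ -subset_meanD mulrDr expRD mulrC.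
apply: le_trans (ler_wpM2r _ IH); last exact: expR_ge0.
rewrite mulrC -subset_meanZ; apply: le_subset_mean => E ED.
have lipe : `|f (e |: E) - f E| <= c e by rewrite lip // setU11.
have {lamc}lamce : lam * c e <= 1 / 2 by rewrite lamc // setU11.
(* With d the change of [f] caused by [e], [f (e |: E)] is [h E] + (1 - p)d and [f E] is [h E] -
   pd. *)
rewrite -[lam * (_ - f (e |: E))](_ : lam * (subset_mean D h - h E) +
   lam * (1 - p) * - (f (e |: E) - f E) = _); last by rewrite /h; ring.
rewrite -[lam * (_ - f E)](_ : lam * (subset_mean D h - h E) +
   lam * p * (f (e |: E) - f E) = _); last by rewrite /h; ring.
rewrite !expRD mulrCA [X in _ + X]mulrCA -mulrDr mulrC.
apply: ler_wpM2r; first exact: expR_ge0.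
move: (f (e |: E) - f E) lipe => d lipe.
have [ld1 ld2] : lam * d <= lam * c e /\ - (lam * c e) <= lam * d.
  move: lipe; rewrite ler_norml => /andP[? ?]; split; nra.
have d2 : d ^+ 2 <= c e ^+ 2.
  by move: lipe; rewrite ler_norml => /andP[? ?]; nra.
have c0 : 0 <= c e by apply: le_trans lipe.
have lc0 : 0 <= lam * c e by exact: mulr_ge0.
have half (a t : R) : 0 <= a -> a <= 1 -> t <= 1 / 2 -> a * t <= 1 / 2.
  by move=> a0 a1 t2; have := ler_wpM2l a0 t2; lra.
have e1 : expR (lam * (1 - p) * - d) <=
   1 + lam * (1 - p) * - d + 2 * (lam * (1 - p) * - d) ^+ 2.
  apply: expR_le_quadratic.
  have -> : lam * (1 - p) * - d = (1 - p) * - (lam * d) by ring.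
  by apply: half; lra.
have e2 : expR (lam * p * d) <= 1 + lam * p * d + 2 * (lam * p * d) ^+ 2.
  apply: expR_le_quadratic.
  have -> : lam * p * d = p * (lam * d) by ring.
  by apply: half; lra.
(* Weighted by [p] and [1 - p], the linear terms cancel and the quadratic ones add up to 2 lam^2 p(1
   - p) d^2. *)
apply: le_trans (expR_ge1Dx _).
have q0 : 0 <= 1 - p by lra.
have := ler_wpM2l p_ge0 e1; have := ler_wpM2l q0 e2.
have : 0 <= lam ^+ 2 * (c e ^+ 2 - d ^+ 2) by rewrite mulr_ge0 ?sqr_ge0 ?subr_ge0.
have : 0 <= lam ^+ 2 * d ^+ 2 * (1 - p * (1 - p)).
  have q1 : 0 <= 1 - p * (1 - p) by have := sqr_ge0 p; lra.
  by apply: mulr_ge0 q1; apply: mulr_ge0; apply: sqr_ge0.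
by move: (expR _) (expR _) => X Y; lra.
Qed.

End RandomSubset.

(** * Weighted sums over subsets *)

Section SubsetSums.
Local Open Scope set_scope.
Variables (R : realType) (T : finType).
Implicit Types (D Q : {set T}) (g : T -> R).

Lemma sum_prod_subset D g :
  \sum_(Q : {set T} | Q \subset D) \prod_(t in Q) g t = \prod_(t in D) (1 + g t).
Proof.
elim/set1U_ind: D => [|e D eD IH].
  by rewrite big_set0 (big_pred1 set0) ?big_set0 // => Q; rewrite subset0.
rewrite big_setU1 //= -IH mulrDl mul1r addrC (bigID (fun Q : {set T} => e \in Q)) /=.
congr (_ + _); last by apply: eq_bigl => Q; rewrite -subsetD1 setU1K.
rewrite (reindex_onto (fun Q => e |: Q) (fun Q => Q :\ e)) /=; last first.
  by move=> Q /andP[_ eQ]; rewrite setD1K.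
have QD Q : (e |: Q \subset e |: D) && (e \in e |: Q) && ((e |: Q) :\ e == Q) =
            (Q \subset D).
  apply/idP/idP.
    by move=> /andP[/andP[QD _] /eqP <-]; rewrite subDset.
  move=> QD; rewrite setUS // setU11 /= setU1K //.
  by apply: contra eD; exact: (subsetP QD).
rewrite big_distrr; apply: eq_big => // Q; rewrite QD => /subsetP QD'.
by rewrite big_setU1 //; apply: contra eD; exact: QD'.
Qed.

Lemma prod1D_le_expR D g : (forall t, 0 <= g t) ->
  \prod_(t in D) (1 + g t) <= expR (\sum_(t in D) g t).
Proof.
move=> g0; rewrite expR_sum; apply: ler_prod => t _.
by rewrite expR_ge1Dx addr_ge0.
Qed.

(** Dividing the weights by [s] costs a set of at most [k] elements a factor at most [s ^+ k]; the
    rescaled weights, summed over all subsets, give at most e. *)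
Lemma sum_small_subsets D g (s : R) k : 1 <= s -> (forall t, 0 <= g t) ->
  \sum_(t in D) g t <= s ->
  \sum_(Q : {set T} | (Q \subset D) && (#|Q| <= k)%N) \prod_(t in Q) g t <=
  expR 1 * s ^+ k.
Proof.
move=> s1 g0 gs; have s0 : 0 < s by apply: lt_le_trans s1.
have gs0 t : 0 <= g t / s by rewrite divr_ge0 // ltW.
have -> : expR 1 * s ^+ k = s ^+ k * expR 1 :> R by rewrite mulrC.
apply: (@le_trans _ _ (s ^+ k * \prod_(t in D) (1 + g t / s))); last first.
  apply: ler_wpM2l; first by rewrite exprn_ge0 // ltW.
  apply: le_trans (prod1D_le_expR _ gs0) _.
  by rewrite ler_expR -mulr_suml ler_pdivrMr // mul1r.
rewrite -sum_prod_subset big_distrr /=.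
rewrite [leRHS](bigID (fun Q : {set T} => #|Q| <= k)%N) /= -[leLHS]addr0.
apply: lerD; last first.
  by apply: sumr_ge0 => Q _; apply: mulr_ge0; [exact: exprn_ge0 (ltW s0)|exact: prodr_ge0].
apply: ler_sum => Q /andP[_ Qk].
rewrite big_split /= prodr_const mulrCA -[leLHS]mulr1.
apply: ler_wpM2l; first exact: prodr_ge0.
rewrite exprVn ler_pdivlMr ?exprn_gt0 // mul1r.
exact: ler_weXn2l.
Qed.

Lemma card_small_subsets D (s : R) k : 1 <= s -> #|D|%:R <= s ->
  #|[set Q : {set T} | (Q \subset D) && (#|Q| <= k)%N]|%:R <= expR 1 * s ^+ k.
Proof.
move=> s1 Ds; have := @sum_small_subsets D (fun=> 1) s k s1.
rewrite sumr_const => /(_ (fun=> ler01) Ds); apply: le_trans.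
rewrite -sum1_card natr_sum big_mkcond /= [leRHS]big_mkcond /=.
by apply: ler_sum => Q _; rewrite inE; case: ifP => // _; rewrite big1.
Qed.

End SubsetSums.

(** * Edges covered by a family of small sides *)

Section Uncovered.
Local Open Scope set_scope.
Variables (R : realType) (T : finType).
Implicit Types (A U V e : {set T}) (AA E : {set {set T}}) (x y z : T).

Definition spokes A y : {set {set T}} := [set [set z; y] | z in A].

(* If xy is an edge of a biclique with sides A and B, with x in A, then y is
   joined to all of A.  An edge xy is uncovered when no A in AA allows this, from
   either end; each uncovered edge gives two ordered uncovered pairs. *)
Definition side_uncovered AA (E : {set {set T}}) x y : bool :=
  [forall A in AA, (x \in A) && (y \notin A) ==> ~~ (spokes (A :\ x) y \subset E)].

Definition uncovered AA (E : {set {set T}}) x y : bool :=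
  [&& x != y, [set x; y] \in E, side_uncovered AA E x y & side_uncovered AA E y x].

Definition uncovered_pairs AA U (E : {set {set T}}) : {set T * T} :=
  [set xy | [&& xy.1 \in U, xy.2 \in U & uncovered AA E xy.1 xy.2]].

Lemma set2_injl x z y : [set x; y] = [set z; y] -> x = z.
Proof.
move=> /setP eq_xz; have := eq_xz x; have := eq_xz z; rewrite !inE !eqxx /=.
by case: eqP => [->|_]; case: eqP => [->|_] //=; case: eqP => // ->.
Qed.

Lemma card_spokes A y : #|spokes A y| = #|A|.
Proof. by rewrite card_imset // => x z; exact: set2_injl. Qed.

Lemma set2_vertex_pairs x y V : x != y -> x \in V -> y \in V ->
  [set x; y] \in vertex_pairs V.
Proof.
by move=> xy xV yV; rewrite inE cards2 xy eqxx andbT subUset !sub1set xV.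
Qed.

Lemma spokes_sub A y V : y \notin A -> A \subset V -> y \in V ->
  spokes A y \subset vertex_pairs V.
Proof.
move=> yA /subsetP AV yV; apply/subsetP => _ /imsetP[z zA ->].
by apply: set2_vertex_pairs (AV _ zA) yV; apply: contraNneq yA => <-.
Qed.

Lemma sub_setU1_notin (F E : {set {set T}}) e : e \notin F ->
  (F \subset e |: E) = (F \subset E).
Proof.
move=> eF; apply/idP/idP => [FE|]; last by move/subset_trans; apply; exact: subsetUr.
move/subsetP: FE => FE; apply/subsetP => f fF.
by case/setU1P: (FE f fF) => // fe; rewrite -fe fF in eF.
Qed.

Lemma side_uncovered_setU1 AA (E : {set {set T}}) e x y :
  (forall A, A \in AA -> x \in A -> y \notin A -> e \notin spokes (A :\ x) y) ->
  side_uncovered AA (e |: E) x y = side_uncovered AA E x y.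
Proof.
move=> eA; apply: eq_forallb_in => A AAA.
case: (boolP (_ && _)) => //= /andP[xA yA].
by rewrite sub_setU1_notin // eA.
Qed.

Lemma edge_notin_spokes A x y : [set x; y] \notin spokes (A :\ x) y.
Proof.
apply/imsetP => -[z zA /set2_injl xz].
by move: zA; rewrite -xz !inE eqxx.
Qed.

(** If [A] contains [x] but not [y], its other vertices are all joined to [y] with probability
    [p ^+ #|A|.-1]. The product is a lower bound, the same for all [y], for the probability that
    this happens for no [A]. *)
Definition escape_prob (p : R) AA x : R :=
  \prod_(A in AA | x \in A) (1 - p ^+ #|A|.-1).

Lemma side_uncoveredE AA (E : {set {set T}}) x y :
  (side_uncovered AA E x y)%:R =
  \prod_(A | [&& A \in AA, x \in A & y \notin A])
     (~~ (spokes (A :\ x) y \subset E))%:R :> R.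
Proof.
case: (boolP (side_uncovered AA E x y)) => [/forall_inP unc|].
  by rewrite big1 // => A /andP[/unc /implyP uA /uA ->].
rewrite negb_forall_in => /exists_inP[A AAA]; rewrite negb_imply => /andP[xyA nA].
by rewrite (bigD1 A) ?AAA //= (negbTE nA) mul0r.
Qed.

(** * Probability that a given pair is an uncovered edge *)

Section Mean.
Variable p : R.
Hypotheses (p_ge0 : 0 <= p) (p_le1 : p <= 1).
Let D := vertex_pairs [set: T].

Lemma mean_side_uncovered AA x y : x != y ->
  escape_prob p AA x <= subset_mean p D (fun E => (side_uncovered AA E x y)%:R).
Proof.
move=> xy.
have -> : subset_mean p D (fun E => (side_uncovered AA E x y)%:R) =
  subset_mean p D (fun E => \prod_(A | [&& A \in AA, x \in A & y \notin A])
     (~~ (spokes (A :\ x) y \subset E))%:R).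
  by apply: eq_subset_mean => E _; exact: side_uncoveredE.
apply: le_trans (subset_mean_nsub _ _ _); rewrite ?p_ge0 ?p_le1 //; last first.
  move=> A /and3P[_ _ yA]; apply: spokes_sub; rewrite ?inE ?subsetT //.
  by rewrite (negbTE yA) andbF.
have fact A : 0 <= 1 - p ^+ #|A|.-1 <= 1.
  by rewrite subr_ge0 exprn_ile1 //= lerBlDr lerDl exprn_ge0.
(* Sets containing both [x] and [y] only contribute factors at most 1 to [escape_prob]. *)
rewrite /escape_prob (bigID (fun A => y \in A)) /= mulrC.
apply: (@le_trans _ _ (\prod_(A | (A \in AA) && (x \in A) && (y \notin A)) (1 - p ^+ #|A|.-1))).
  rewrite ler_piMr //; first by apply: prodr_ge0 => A _; case/andP: (fact A).
  by apply: prodr_ile1 => A _; exact: fact.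
rewrite le_eqVlt; apply/orP; left; apply/eqP; apply: eq_big.
  by move=> A; rewrite andbA.
move=> A /andP[/andP[_ xA] _]; rewrite card_spokes.
by rewrite [in LHS](cardsD1 x) xA.
Qed.

(** The edge [xy] is none of the spokes tested at either end, so it gives an independent factor [p];
    the two side conditions are decreasing in [E] and Harris' inequality combines them. *)
Lemma mean_uncovered AA x y : x != y ->
  p * (escape_prob p AA x * escape_prob p AA y) <=
  subset_mean p D (fun E => (uncovered AA E x y)%:R).
Proof.
move=> xy; pose g1 (E : {set {set T}}) : R := (side_uncovered AA E x y)%:R.
pose g2 (E : {set {set T}}) : R := (side_uncovered AA E y x)%:R.
have -> : subset_mean p D (fun E => (uncovered AA E x y)%:R) =
  subset_mean p D (fun E => ([set x; y] \in E)%:R * (g1 E * g2 E)).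
  apply: eq_subset_mean => E _; rewrite /uncovered xy /g1 /g2 /=.
  by case: (_ \in E); case: side_uncovered; case: side_uncovered; rewrite /=; ring.
have exyD : [set x; y] \in D by apply: set2_vertex_pairs; rewrite ?inE.
rewrite (subset_mean_mem _ exyD); last first.
  move=> E; rewrite /g1 /g2 !side_uncovered_setU1 // => A _ _ _.
    by rewrite setUC edge_notin_spokes.
  exact: edge_notin_spokes.
apply: ler_wpM2l => //.
have anti a b : antitone (fun E => (side_uncovered AA E a b)%:R : R).
  move=> E E' EE'; rewrite !side_uncoveredE; apply: ler_prod => A _.
  by rewrite ler0n antitone_nsub.
apply: le_trans (subset_mean_harris p_ge0 p_le1 D (anti x y) (anti y x)).
have e0 z : 0 <= escape_prob p AA z.
  by apply: prodr_ge0 => A _; rewrite subr_ge0 exprn_ile1.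
by apply: ler_pM; rewrite ?mean_side_uncovered // eq_sym.
Qed.

End Mean.

(** * Effect of adding one edge on the uncovered pairs *)

Definition linked AA z : {set T} := z |: \bigcup_(A in AA | z \in A) A.

Lemma card_linked AA (K L : nat) z :
  (forall A, A \in AA -> (#|A| <= L)%N) ->
  (#|[set A in AA | z \in A]| <= K)%N -> (#|linked AA z| <= (K * L).+1)%N.
Proof.
move=> AL degK; rewrite cardsU1 -add1n leq_add ?leq_b1 //.
apply: leq_trans (_ : \sum_(A in [set A in AA | z \in A]) #|A| <= _)%N.
  rewrite (eq_bigl (mem [set A in AA | z \in A])) => [|A]; last by rewrite !inE.
  elim/big_rec2: _ => [|A n B _ IH]; first by rewrite cards0.
  by apply: leq_trans (leq_card_setU _ _).1 _; rewrite leq_add2l.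
apply: leq_trans (_ : \sum_(A in [set A in AA | z \in A]) L <= _)%N.
  by apply: leq_sum => A; rewrite inE => /andP[/AL].
by rewrite sum_nat_const leq_mul2r degK orbT.
Qed.

Lemma mem_linked AA A x z : A \in AA -> x \in A -> z \in A -> x \in linked AA z.
Proof.
by move=> AAA xA zA; rewrite in_setU1; apply/orP; right; apply/bigcupP; exists A; rewrite ?AAA.
Qed.

(** A spoke zy with z in [A] matters only to pairs xy with x in [A]. So [e] can affect a pair only
    if one vertex of the pair lies in [e] and the other in this set. *)
Definition linked_edge AA e : {set T} := \bigcup_(z in e) linked AA z.

Lemma side_uncovered_far AA E e x y :
  ~~ ((x \in linked_edge AA e) && (y \in e)) ->
  side_uncovered AA (e |: E) x y = side_uncovered AA E x y.
Proof.
move=> far; apply: side_uncovered_setU1 => A AAA xA yA.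
apply: contra far => /imsetP[z]; rewrite !inE => /andP[_ zA] ->.
rewrite set22 andbT; apply/bigcupP; exists z; rewrite ?set21 //.
exact: mem_linked AAA xA zA.
Qed.

Lemma uncovered_far AA E e x y :
  ~~ ((x \in linked_edge AA e) && (y \in e)) ->
  ~~ ((y \in linked_edge AA e) && (x \in e)) ->
  uncovered AA (e |: E) x y = uncovered AA E x y.
Proof.
move=> farx fary; rewrite /uncovered !side_uncovered_far // in_setU1.
case: ([set x; y] =P e) => // exy; case/negP: farx; rewrite -exy set22 andbT.
by apply/bigcupP; exists x; rewrite ?set21 // setU11.
Qed.

(** At most [2 * (K * L).+1] vertices are linked to [e]; pairing them with the 2 vertices of [e], in
    both orders, gives the constant 8. *)
Lemma uncovered_pairs_lipschitz AA U E e (K L : nat) : #|e| = 2 ->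
  (forall A, A \in AA -> (#|A| <= L)%N) ->
  (forall z, (#|[set A in AA | z \in A]| <= K)%N) ->
  `|#|uncovered_pairs AA U (e |: E)|%:R - #|uncovered_pairs AA U E|%:R|
    <= (8 * (K * L).+1)%:R :> R.
Proof.
move=> e2 AL degK.
pose X := setX (linked_edge AA e) e :|: setX e (linked_edge AA e).
have cardN : (#|linked_edge AA e| <= 2 * (K * L).+1)%N.
  apply: leq_trans (_ : \sum_(z in e) #|linked AA z| <= _)%N.
    rewrite /linked_edge; elim/big_rec2: _ => [|z n B _ IH]; first by rewrite cards0.
    by apply: leq_trans (leq_card_setU _ _).1 _; rewrite leq_add2l.
  apply: leq_trans (_ : \sum_(z in e) (K * L).+1 <= _)%N.
    by apply: leq_sum => z _; apply: card_linked.
  by rewrite sum_nat_const e2.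
have cardX : (#|X| <= 8 * (K * L).+1)%N.
  apply: leq_trans (leq_card_setU _ _).1 _; rewrite !cardsX e2; lia.
have sub E1 E2 : (forall x y, (x, y) \notin X ->
    uncovered AA E1 x y = uncovered AA E2 x y) ->
  (#|uncovered_pairs AA U E1| <= #|uncovered_pairs AA U E2| + #|X|)%N.
  move=> same; apply: leq_trans (leq_card_setU _ _).1.
  apply: subset_leq_card; apply/subsetP => -[x y]; rewrite inE /= => /and3P[xU yU unc].
  rewrite in_setU; case: (boolP (_ \in X)) => [|nX]; rewrite ?orbT // orbF.
  by rewrite inE /= xU yU -same.
have far x y : (x, y) \notin X -> uncovered AA (e |: E) x y = uncovered AA E x y.
  rewrite in_setU !in_setX /= negb_or => /andP[f1 f2].
  by rewrite uncovered_far // andbC.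
have h1 := sub _ _ far; have h2 := sub _ _ (fun x y H => esym (far x y H)).
rewrite ler_distl lerBlDr -!natrD !ler_nat.
by apply/andP; split; lia.
Qed.

(** Every spoke and pair involved lies inside [U]. Hence only about [#|U| ^ 2] variables enter the
    concentration bound, however large the graph. *)
Lemma uncovered_pairs_setU1 AA U E e :
  (forall A, A \in AA -> A \subset U) -> ~~ (e \subset U) ->
  uncovered_pairs AA U (e |: E) = uncovered_pairs AA U E.
Proof.
move=> AU eU; apply/setP => -[x y]; rewrite !inE /=.
case: (boolP (x \in U)) => //= xU; case: (boolP (y \in U)) => //= yU.
have sub2 a b : a \in U -> b \in U -> e != [set a; b].
  by move=> aU bU; apply: contraNneq eU => ->; rewrite subUset !sub1set aU.
have side a b : a \in U -> b \in U ->
    side_uncovered AA (e |: E) a b = side_uncovered AA E a b.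
  move=> aU bU; apply: side_uncovered_setU1 => A AAA _ _; apply/imsetP => -[z].
  rewrite !inE => /andP[_ zA]; apply/eqP/sub2 => //.
  exact: (subsetP (AU _ AAA)).
by rewrite /uncovered !side // in_setU1 (eq_sym _ e) (negbTE (sub2 _ _ xU yU)).
Qed.

(** * Mean and lower tail of the number of uncovered pairs *)

Lemma expRN2_le (t : R) : 0 <= t -> t <= 1 / 2 -> expR (- (2 * t)) <= 1 - t.
Proof.
move=> t0 t2; rewrite expRN -[leLHS]mul1r ler_pdivrMr ?expR_gt0 //.
have q0 : 0 <= 1 - t by lra.
apply: le_trans (ler_wpM2l q0 (expR_ge1Dx (2 * t))).
(* (1 - t)(1 + 2t) = 1 + t(1 - 2t), and exp(2t) is at least 1 + 2t. *)
by have := mulr_ge0 t0 (_ : 0 <= 1 - 2 * t); nra.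
Qed.

(* escape_prob is at least exp (-2 load) when p <= 1/2, and the average load is
   at most #|AA| / #|U|, because n <= 2 ^ (n - 1). *)
Definition load AA x : R := \sum_(A in AA | x \in A) (1 / 2) ^+ #|A|.-1.

Lemma expR_load_le (p : R) AA x : 0 <= p -> p <= 1 / 2 ->
  (forall A, A \in AA -> (2 <= #|A|)%N) ->
  expR (- (2 * load AA x)) <= escape_prob p AA x.
Proof.
move=> p0 p2 A2; rewrite /load /escape_prob -mulNr big_distrr /= expR_sum.
apply: ler_prod => A /andP[/A2 A2' _]; rewrite expR_ge0 /=.
set t := _ ^+ _; have t0 : 0 <= t by apply: exprn_ge0; lra.
have t2 : t <= 1 / 2.
  rewrite /t -[leRHS]expr1; apply: ler_wiXn2l; [lra|lra|lia].
rewrite mulNr; apply: le_trans (expRN2_le t0 t2) _.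
by rewrite lerD2l lerN2; apply: lerXn2r => //; rewrite nnegrE //; lra.
Qed.

Lemma sum_load U AA : (forall A, A \in AA -> (0 < #|A|)%N) ->
  \sum_(x in U) load AA x <= #|AA|%:R.
Proof.
move=> A0; rewrite /load.
rewrite (exchange_big_dep (mem AA)) /=; last by move=> x A _ /andP[].
rewrite -sum1_card natr_sum; apply: ler_sum => A AAA.
rewrite sumr_const.
apply: (@le_trans _ _ ((1 / 2) ^+ #|A|.-1 *+ #|A|)).
  rewrite -[leLHS]mulr_natr -[leRHS]mulr_natr; apply: ler_wpM2l; first by apply: exprn_ge0; lra.
  rewrite ler_nat.
  by apply: subset_leq_card; apply/subsetP => x /and3P[].
rewrite -mulr_natr; have := A0 _ AAA; case: #|A| => // n _ /=.
elim: n => [|n]; first by rewrite expr0 mul1r.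
rewrite exprS; set t := _ ^+ n; have t0 : 0 <= t by apply: exprn_ge0; lra.
rewrite -[n.+2]addn1 -[n.+1]addn1 !natrD => IH.
have : 0 <= t * n%:R by rewrite mulr_ge0.
lra.
Qed.

(** Markov's inequality: the average load over [U] is at most 2, so at most half of [U] has load
    above 4. *)
Lemma count_low_load U AA : (forall A, A \in AA -> (0 < #|A|)%N) ->
  (#|AA| <= 2 * #|U|)%N ->
  #|U|%:R / 2 <= #|[set x in U | load AA x <= 4]|%:R :> R.
Proof.
move=> A0 AAU; set U1 := [set _ in _ | _].
have l0 x : 0 <= load AA x by apply: sumr_ge0 => A _; apply: exprn_ge0; lra.
have h : 4 * #|U :\: U1|%:R <= \sum_(x in U) load AA x.
  rewrite (big_setID (U :\: U1)) /= setIDA setIid.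
  rewrite -[leLHS]addr0; apply: lerD; last by apply: sumr_ge0 => x _.
  rewrite mulr_natr -sumr_const; apply: ler_sum => x.
  by rewrite !inE => /andP[nU xU]; move: nU; rewrite xU /= -ltNge => /ltW.
have := le_trans h (sum_load U A0).
have : #|AA|%:R <= 2 * #|U|%:R :> R by rewrite -natrM ler_nat.
have : #|U|%:R = #|U :\: U1|%:R + #|U1|%:R :> R.
  rewrite -natrD; congr (_%:R).
  have U1U : U1 \subset U by apply/subsetP => x; rewrite inE => /andP[].
  by rewrite -[LHS](cardsID U1) (setIidPr U1U) addnC.
lra.
Qed.
(** Vertices of load at most 4 escape with probability at least exp(-8), so two distinct ones form
    an uncovered edge with probability at least p exp(-16). *)
Lemma mean_uncovered_pairs (p : R) AA U : 0 <= p -> p <= 1 / 2 ->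
  (forall A, A \in AA -> (2 <= #|A|)%N) ->
  (#|AA| <= 2 * #|U|)%N -> (4 <= #|U|)%N ->
  p * expR (- 16) / 8 * #|U|%:R ^+ 2 <=
  subset_mean p (vertex_pairs [set: T])
    (fun E => #|uncovered_pairs AA U E|%:R).
Proof.
move=> p0 p2 A2 AAU U4; have p1 : p <= 1 by lra.
have -> : subset_mean p (vertex_pairs [set: T])
    (fun E => #|uncovered_pairs AA U E|%:R : R) =
  subset_mean p (vertex_pairs [set: T])
    (fun E => \sum_(xy | (xy.1 \in U) && (xy.2 \in U))
                (uncovered AA E xy.1 xy.2)%:R : R).
  apply: eq_subset_mean => E _; rewrite -sum1_card natr_sum.
  rewrite big_mkcond [RHS]big_mkcond; apply: eq_bigr => -[x y] _; rewrite inE /=.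
  by case: (x \in U); case: (y \in U); case: uncovered.
rewrite subset_mean_sum; set U1 := [set x in U | load AA x <= 4].
pose P1 := setX U1 U1 :\: [set (x, x) | x in U1].
apply: (@le_trans _ _ (\sum_(xy in P1) p * expR (- 16))); last first.
  rewrite [leRHS](bigID (mem P1)) /= -[leLHS]addr0; apply: lerD; last first.
    by apply: sumr_ge0 => xy _; apply: subset_mean_ge0 => //; lra.
  have PU (xy : T * T) : (xy \in P1) =
      (xy.1 \in U) && (xy.2 \in U) && (xy \in P1).
    apply/idP/idP => [h|/andP[] //]; rewrite h andbT; move: h; rewrite !inE.
    by case/and3P=> _ /andP[-> _] /andP[-> _].
  rewrite (eq_bigl _ _ PU).
  apply: ler_sum => -[x y] /= /andP[_]; rewrite !inE /=.
  move=> /and3P[nxy /andP[xU lx] /andP[yU ly]].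
  have xy : x != y.
    apply: contra nxy => /eqP <-; apply/imsetP; exists x => //.
    by rewrite inE xU lx.
  apply: le_trans (mean_uncovered p0 p1 AA xy); apply: ler_wpM2l => //.
  have -> : - 16 = - 8 + - 8 :> R by lra.
  rewrite expRD; apply: ler_pM; rewrite ?expR_ge0 //.
    by apply: le_trans (expR_load_le x p0 p2 A2); rewrite ler_expR; lra.
  by apply: le_trans (expR_load_le y p0 p2 A2); rewrite ler_expR; lra.
rewrite sumr_const -[leRHS]mulr_natr -[leLHS]mulrA; apply: ler_wpM2l.
  by rewrite mulr_ge0 ?expR_ge0.
have cardP1 : #|U1|%:R ^+ 2 <= #|P1|%:R + #|U1|%:R :> R.
  rewrite -natrX -natrD ler_nat -mulnn -cardsX.
  rewrite -(cardsID [set (x, x) | x in U1] (setX U1 U1)) addnC leq_add2l.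
  apply: leq_trans (_ : #|[set (x, x) | x in U1]| <= _)%N.
    by apply: subset_leq_card; apply: subsetIr.
  exact: leq_imset_card.
have A0 A : A \in AA -> (0 < #|A|)%N by move=> /A2; apply: leq_trans.
have := count_low_load A0 AAU; rewrite -/U1.
have : 4 <= #|U|%:R :> R by rewrite ler_nat.
move: cardP1; move: (#|U|%:R) (#|U1|%:R) (#|P1|%:R) => u a b ab u4 ua.
(* As a >= u/2 and u >= 4, a^2 - a >= u^2/4 - u/2 >= u^2/8. *)
have h1 : 0 <= (a - u / 2) * (a + u / 2 - 1) by apply: mulr_ge0; lra.
have h2 : 0 <= u * (u - 4) by apply: mulr_ge0; lra.
lra.
Qed.

Lemma card_pairs_in U : (#|[set e in vertex_pairs [set: T] | e \subset U]| <= #|U| ^ 2)%N.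
Proof.
have -> : [set e in vertex_pairs [set: T] | e \subset U] =
          [set e : {set T} | (e \subset U) && (#|e| == 2)].
  by apply/setP => e; rewrite !inE subsetT /= andbC.
rewrite cards_draws bin2 -mulnn; case: #|U| => // n /=.
by rewrite -divn2; apply: leq_trans (leq_div _ _) _; rewrite leq_mul2l; lia.
Qed.

(** Exponential Markov inequality for a drop to half the lower bound on the mean, with Lipschitz
    constant [c] for pairs inside [U] and 0 for the others. *)
Lemma uncovered_tail (p : R) AA U (K L : nat) :
  let q := p * expR (- 16) / 8 in
  let c := (8 * (K * L).+1)%:R in
  0 <= p -> p <= 1 / 2 ->
  (forall A, A \in AA -> [/\ A \subset U, (2 <= #|A|)%N & (#|A| <= L)%N]) ->
  (forall z, (#|[set A in AA | z \in A]| <= K)%N) ->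
  (#|AA| <= 2 * #|U|)%N -> (4 <= #|U|)%N ->
  subset_mean p (vertex_pairs [set: T])
    (fun E => (#|uncovered_pairs AA U E|%:R <= q / 2 * #|U|%:R ^+ 2)%R%:R) <=
  expR (- (q ^+ 2 / (32 * c ^+ 2)) * #|U|%:R ^+ 2).
Proof.
move=> q c p0 p2 AAp degK AAU U4; have p1 : p <= 1 by lra.
set D := vertex_pairs _; set m := #|U|%:R.
pose f E : R := #|uncovered_pairs AA U E|%:R.
have mean_f : q * m ^+ 2 <= subset_mean p D f.
  by apply: mean_uncovered_pairs => // A /AAp[].
have c1 : 8 <= c by rewrite ler_nat; lia.
have c0 : 0 < c by lra.
have q0 : 0 <= q by rewrite divr_ge0 ?mulr_ge0 ?expR_ge0.
have q1 : q <= 1.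
  have e1 : expR (- 16) <= 1 :> R by rewrite -[leRHS]expR0 ler_expR; lra.
  have := ler_wpM2l p0 e1; rewrite /q; lra.
clearbody q.
(* This minimises [- lam * q / 2 + 2 * lam ^+ 2 * c ^+ 2], the coefficient of [m ^+ 2] in the
   exponent. *)
pose lam := q / (8 * c ^+ 2).
have lam0 : 0 <= lam by rewrite divr_ge0 // mulr_ge0 // exprn_ge0 // ltW.
pose ce e : R := if e \subset U then c else 0.
have lamc : lam * c <= 1 / 2.
  rewrite /lam expr2 invfM invfM.
  have -> : q * (8^-1 * (c^-1 * c^-1)) * c = q * (8^-1 * c^-1) * (c^-1 * c) by ring.
  rewrite mulVf ?gt_eqF // mulr1.
  have cV : c^-1 <= 1 by rewrite invf_le1 //; lra.
  by move: (ler_wpM2l q0 cV); rewrite mulrCA; move: (q / c) => x; lra.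
have := @subset_mean_lipschitz _ _ p p0 p1 D f ce lam lam0.
have lip e E : e \in D -> `|f (e |: E) - f E| <= ce e.
  rewrite inE => /andP[_ /eqP e2]; rewrite /ce; case: ifPn => eU.
    by apply: uncovered_pairs_lipschitz => // A /AAp[].
  by rewrite /f uncovered_pairs_setU1 ?subrr ?normr0 // => A /AAp[].
have lamce e : e \in D -> lam * ce e <= 1 / 2.
  by move=> _; rewrite /ce; case: ifP => // _; rewrite mulr0; lra.
move=> /(_ lip lamce) main.
have sum_c : \sum_(e in D) ce e ^+ 2 <= c ^+ 2 * m ^+ 2.
  rewrite (bigID (fun e : {set T} => e \subset U)) /= [X in _ + X]big1 ?addr0; last first.
    by move=> e /andP[_ eU]; rewrite /ce (negbTE eU) expr0n.
  rewrite (eq_bigr (fun=> c ^+ 2)) => [|e /andP[_ eU]]; last by rewrite /ce eU.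
  rewrite sumr_const -[leLHS]mulr_natr; apply: ler_wpM2l; first exact: sqr_ge0.
  rewrite -natrX ler_nat; apply: leq_trans (card_pairs_in U).
  by apply: subset_leq_card; apply/subsetP => e /andP[eD eU]; rewrite inE eD.
apply: (@le_trans _ _ (subset_mean p D (fun E =>
   expR (- (lam * (q / 2 * m ^+ 2))) * expR (lam * (subset_mean p D f - f E))))).
  apply: le_subset_mean => // E _.
  case: (boolP (#|uncovered_pairs AA U E|%:R <= q / 2 * m ^+ 2)) => [fE|_]; last first.
    by rewrite mulr_ge0 ?expR_ge0.
  rewrite -expRD -[leLHS]expR0 ler_expR -mulrN -mulrDr mulr_ge0 //.
  by move: fE mean_f; rewrite /f; lra.
rewrite subset_meanZ; apply: le_trans (ler_wpM2l (expR_ge0 _) main) _.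
rewrite -expRD ler_expR.
have := ler_wpM2l (sqr_ge0 lam) sum_c.
set S := \sum_(e in D) _ => hS.
have e1 : lam ^+ 2 * (c ^+ 2 * m ^+ 2) = q ^+ 2 / (64 * c ^+ 2) * m ^+ 2.
  by rewrite /lam; field; rewrite gt_eqF.
have e2 : lam * (q / 2 * m ^+ 2) = q ^+ 2 / (16 * c ^+ 2) * m ^+ 2.
  by rewrite /lam; field; rewrite gt_eqF.
have e3 : q ^+ 2 / (32 * c ^+ 2) * m ^+ 2 =
   q ^+ 2 / (16 * c ^+ 2) * m ^+ 2 - 2 * (q ^+ 2 / (64 * c ^+ 2) * m ^+ 2).
  by field; rewrite gt_eqF.
rewrite mulNr e3 e2 -e1 -[2 * _ * S]mulrA.
have key (x y z : R) : x <= y -> - z + 2 * x <= - (z - 2 * y) by lra.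
exact: key hS.
Qed.

End Uncovered.

(** * Bicliques with two large sides *)

Section LargeBicliques.
Local Open Scope set_scope.
Variables (R : realType) (T : finType).
Implicit Types (A B U : {set T}) (E : {set {set T}}) (q : {set T} * {set T}).
Implicit Types (Q : {set {set T} * {set T}}).

Definition biclique q : {set {set T}} := [set [set x; y] | x in q.1, y in q.2].

Lemma card_biclique q : [disjoint q.1 & q.2] -> #|biclique q| = (#|q.1| * #|q.2|)%N.
Proof.
move=> /pred0P dis; have disP z : z \in q.1 -> z \in q.2 -> false.
  by move=> z1 z2; have := dis z; rewrite /= z1 z2.
rewrite /biclique curry_imset2X card_in_imset ?cardsX // => -[x y] [x' y'] /=.
rewrite !in_setX /= => /andP[xA yB] /andP[xA' yB'] eq_xy.
have : x \in [set x'; y'] by rewrite -eq_xy set21.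
have : y \in [set x'; y'] by rewrite -eq_xy set22.
rewrite !inE => /orP[/eqP yx'|/eqP ->]; first by have := disP _ xA'; rewrite -yx' yB => /(_ isT).
by move=> /orP[/eqP ->|/eqP xy'] //; have := disP _ xA; rewrite xy' yB' => /(_ isT).
Qed.

Definition large_pair U (L b : nat) q : bool :=
  [&& q.1 \subset U, q.2 \subset U, (L <= #|q.1|)%N & (b <= #|q.2|)%N].

Definition edge_disjoint Q : bool :=
  [forall q in Q, [disjoint q.1 & q.2]] &&
  [forall q in Q, [forall q' in Q, (q != q') ==> [disjoint biclique q & biclique q']]].

Definition num_edges Q : nat := \sum_(q in Q) #|q.1| * #|q.2|.

Lemma card_bigcup_biclique Q : edge_disjoint Q ->
  #|\bigcup_(q in Q) biclique q| = num_edges Q.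
Proof.
rewrite /num_edges; elim/set1U_ind: Q => [|q Q qQ IH] ed.
  by rewrite !big_set0 cards0.
move: ed => /andP[/forall_inP dis /forall_inP ed].
rewrite !big_setU1 //= cardsU IH; last first.
  apply/andP; split; apply/forall_inP => q' q'Q.
    by apply: dis; rewrite setU1r.
  apply/forall_inP => q'' q''Q.
  by have /forall_inP := ed q' (setU1r _ q'Q); apply; rewrite setU1r.
rewrite card_biclique; last by apply: dis; rewrite setU11.
rewrite (_ : _ :&: _ = set0) ?cards0 ?subn0 //.
apply/setP => e; rewrite !inE; apply/negP => /andP[eq /bigcupP[q' q'Q eq']].
have /forall_inP/(_ q' (setU1r _ q'Q)) := ed q (setU11 _ _).
have -> /= : q != q' by apply: contraNneq qQ => ->.
by move/pred0P/(_ e); rewrite /= eq eq'.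
Qed.

Lemma biclique_sub q U : q.1 \subset U -> q.2 \subset U -> [disjoint q.1 & q.2] ->
  biclique q \subset vertex_pairs U.
Proof.
move=> /subsetP q1 /subsetP q2 /pred0P dis; apply/subsetP => e /imset2P[x y xA yB ->].
apply: set2_vertex_pairs (q1 _ xA) (q2 _ yB).
by apply/eqP => xy; have := dis x; rewrite /= xA xy yB.
Qed.

Definition large_family U (L b k G : nat) E Q : bool :=
  [&& [forall q in Q, large_pair U L b q], edge_disjoint Q, (#|Q| <= k)%N,
      (G <= num_edges Q)%N & (\bigcup_(q in Q) biclique q \subset E)].

(** Twice |A||B| is at least b|A| + L|B|, so the sum is at most a product of a sum over A and a sum
    over B, each of the form (1 + t)^|U|. *)
Lemma sum_large_pair U (L b : nat) (s : R) : 0 <= s -> s <= 1 ->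
  \sum_(q in [set q | large_pair U L b q]) s ^+ (2 * (#|q.1| * #|q.2|)) <=
  expR (#|U|%:R * (s ^+ b + s ^+ L)).
Proof.
move=> s0 s1.
have sumE (t : R) : 0 <= t -> \sum_(A : {set T} | A \subset U) t ^+ #|A| <= expR (#|U|%:R * t).
  move=> t0; rewrite (eq_bigr (fun A : {set T} => \prod_(x in A) t)) => [|A _]; last first.
    by rewrite prodr_const.
  rewrite sum_prod_subset; apply: le_trans (prod1D_le_expR _ _) _ => //.
  by rewrite sumr_const mulr_natl.
have sum0 (t : R) : 0 <= t -> 0 <= \sum_(A : {set T} | A \subset U) t ^+ #|A|.
  by move=> t0; apply: sumr_ge0 => A _; exact: exprn_ge0.
have [sb sL] : 0 <= s ^+ b /\ 0 <= s ^+ L by split; exact: exprn_ge0.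
rewrite mulrDr expRD.
apply: le_trans (ler_pM (sum0 _ sb) (sum0 _ sL) (sumE _ sb) (sumE _ sL)).
rewrite mulr_suml; under [leRHS]eq_bigr do rewrite mulr_sumr.
rewrite pair_big /= big_mkcond [leRHS]big_mkcond /=.
apply: ler_sum => -[A B] _; rewrite inE /large_pair /=.
have pos : 0 <= (s ^+ b) ^+ #|A| * (s ^+ L) ^+ #|B| by rewrite mulr_ge0 ?exprn_ge0.
case: (A \subset U) => /=; last by [].
case: (B \subset U) => /=; last by [].
case: ifP => // /andP[LA bB]; rewrite -!exprM -exprD.
apply: ler_wiXn2l => //; rewrite mul2n -addnn leq_add //.
  by rewrite mulnC leq_mul2l bB orbT.
by rewrite leq_mul2r LA orbT.
Qed.

(* Half of the exponent in p ^ num_edges pays for the choice of the pairs. *)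
Lemma large_family_prob U (L b k G : nat) (s : R) : 0 <= s -> s <= 1 ->
  subset_mean (s ^+ 4) (vertex_pairs [set: T])
    (fun E => [exists Q, large_family U L b k G E Q]%:R) <=
  s ^+ (2 * G) * expR (1 + (k * #|U|)%:R * (s ^+ b + s ^+ L)).
Proof.
move=> s0 s1; set D := vertex_pairs _; set p := s ^+ 4.
have p0 : 0 <= p by exact: exprn_ge0.
have p1 : p <= 1 by exact: exprn_ile1.
pose V := [set q | large_pair U L b q].
pose ok Q := [&& Q \subset V, edge_disjoint Q, (#|Q| <= k)%N & (G <= num_edges Q)%N].
apply: (@le_trans _ _ (subset_mean p D (fun E =>
   \sum_(Q | ok Q) (\bigcup_(q in Q) biclique q \subset E)%:R))).
  apply: le_subset_mean => // E _; case: existsP => [[Q lQ]|_]; last first.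
    by apply: sumr_ge0 => Q _.
  move: lQ => /and5P[/forall_inP lQ ed Qk GQ subE].
  have okQ : ok Q.
    by rewrite /ok ed Qk GQ !andbT; apply/subsetP => q /lQ; rewrite inE.
  rewrite (bigD1 Q) //= subE -[leLHS]addr0; apply: lerD => //.
  by apply: sumr_ge0.
rewrite subset_mean_sum.
pose g q : R := s ^+ (2 * (#|q.1| * #|q.2|)).
have g0 q : 0 <= g q by exact: exprn_ge0.
apply: (@le_trans _ _ (\sum_(Q | ok Q) s ^+ (2 * G) * \prod_(q in Q) g q)).
  apply: ler_sum => Q /and4P[/subsetP QV ed _ GQ].
  rewrite subset_mean_sub; last first.
    apply/bigcupsP => q qQ; have := QV _ qQ; rewrite inE => /and4P[q1 q2 _ _].
    have dis : [disjoint q.1 & q.2] by case/andP: ed => /forall_inP/(_ q qQ).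
    by apply: biclique_sub; rewrite ?subsetT.
  rewrite card_bigcup_biclique // /p -exprM (_ : 4 * _ = 2 * num_edges Q + 2 * num_edges Q)%N; last lia.
  rewrite exprD; apply: ler_pM; rewrite ?exprn_ge0 //.
    by apply: ler_wiXn2l => //; rewrite leq_mul2l.
  by rewrite /num_edges big_distrr /= expr_sum.
rewrite -mulr_sumr; apply: ler_wpM2l; first exact: exprn_ge0.
(* [S] bounds the total weight of single pairs, so families of at most [k] pairs weigh at most e
   times [S ^+ k]. *)
pose S : R := expR (#|U|%:R * (s ^+ b + s ^+ L)).
have S1 : 1 <= S.
  rewrite /S -[leLHS]expR0 ler_expR mulr_ge0 //.
  by apply: addr_ge0; exact: exprn_ge0.
have gS : \sum_(q in V) g q <= S by exact: sum_large_pair.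
have := sum_small_subsets k S1 g0 gS.
rewrite /S -expRM_natl -expRD mulrA -natrM; apply: le_trans.
rewrite big_mkcond [leRHS]big_mkcond /=; apply: ler_sum => Q _.
rewrite /ok; case: (Q \subset V) => //=; case: (edge_disjoint Q) => //=.
  by case: (#|Q| <= k)%N => //=; case: ifP => // _; apply: prodr_ge0.
by case: ifP => // _; apply: prodr_ge0.
Qed.

End LargeBicliques.

(** * Partitions into bicliques *)

Section Decomposition.
Local Open Scope set_scope.
Variables (T : finType) (U : {set T}) (E : {set {set T}}).
Variable P : {set {set {set T}}}.
Hypothesis bipP : strong_bipartition (induced_edges E U) P.
Implicit Types (A B W : {set T}) (F : {set {set T}}) (x y z : T).

(** The smaller side comes first: a bound on the second side then bounds the whole part, and the
    first sides are the candidates for the family [AA]. *)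
Definition sides_of F (q : {set T} * {set T}) : bool :=
  [&& F == biclique q, [disjoint q.1 & q.2], (2 <= #|q.1|)%N,
      (#|q.1| <= #|q.2|)%N, q.1 \subset U & q.2 \subset U].

Lemma bicliqueC A B : biclique (A, B) = biclique (B, A).
Proof.
apply/setP => e; apply/imset2P/imset2P => -[x y xA yB ->] /=;
by exists y x; rewrite // setUC.
Qed.

Lemma part_sub F : F \in P -> F \subset induced_edges E U.
Proof.
move=> FP; case/andP: bipP => /and3P[/eqP <- _ _] _.
exact: bigcup_sup FP.
Qed.

(** A side with a single vertex would be the centre of a star. *)
Lemma nonstar_side F A B : F = biclique (A, B) -> A != set0 ->
  complete_bipartite F -> ~~ is_star F -> (2 <= #|A|)%N.
Proof.
move=> FE A0 cF; rewrite /is_star cF /=; apply: contraNT; rewrite -ltnNge => A2.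
have /cards1P[a Aa] : #|A| == 1%N by rewrite eqn_leq -ltnS A2 card_gt0.
apply/existsP; exists a; apply/forall_inP => e; rewrite FE.
by move=> /imset2P[x y /=]; rewrite Aa => /set1P -> _ ->; rewrite set21.
Qed.

Lemma sides_exist F : F \in P -> exists q, sides_of F q.
Proof.
move=> FP; have FE := part_sub FP; case/andP: bipP => _ /forall_inP/(_ F FP).
case/andP=> cF nsF.
case/existsP: (cF) => A /existsP[B /and4P[A0 B0 dis /eqP FAB]].
have {}FAB : F = biclique (A, B) by [].
have A2 := nonstar_side FAB A0 cF nsF.
have B2 : (2 <= #|B|)%N.
  by apply: (nonstar_side _ B0 cF nsF); rewrite FAB bicliqueC.
have FU e : e \in F -> e \subset U.
  by move=> /(subsetP FE); rewrite inE => /andP[].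
have inF x y : x \in A -> y \in B -> (x \in U) && (y \in U).
  move=> xA yB; have := FU [set x; y]; rewrite subUset !sub1set; apply.
  by rewrite FAB; apply/imset2P; exists x y.
have AU : A \subset U.
  case/set0Pn: B0 => b bB; apply/subsetP => x xA.
  by case/andP: (inF _ _ xA bB).
have BU : B \subset U.
  case/set0Pn: A0 => a aA; apply/subsetP => y yB.
  by case/andP: (inF _ _ aA yB).
have [AB|BA] := leqP #|A| #|B|.
  by exists (A, B); rewrite /sides_of FAB eqxx dis A2 AB AU BU.
exists (B, A); rewrite /sides_of FAB bicliqueC eqxx /= disjoint_sym dis B2.
by rewrite (ltnW BA) AU BU.
Qed.

(** The default pair of empty sets never occurs for [F] in [P], by [sidesP]. *)
Definition sides F : {set T} * {set T} :=
  odflt (set0, set0) [pick q | sides_of F q].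

Lemma sidesP F : F \in P -> sides_of F (sides F).
Proof.
move=> /sides_exist[q qF]; rewrite /sides; case: pickP => //= /(_ q).
by rewrite qF.
Qed.

Lemma part_biclique F : F \in P -> F = biclique (sides F).
Proof. by move=> /sidesP/and5P[/eqP]. Qed.

Lemma sides_inj : {in P &, injective sides}.
Proof. by move=> F F' FP F'P eqs; rewrite (part_biclique FP) eqs -part_biclique. Qed.

Lemma part_disjoint F F' e : F \in P -> F' \in P -> e \in F -> e \in F' -> F = F'.
Proof.
move=> FP F'P eF eF'; case/andP: bipP => /and3P[_ tI _] _.
by rewrite -(def_pblock tI FP eF) -(def_pblock tI F'P eF').
Qed.

(** An uncovered pair is an edge of some part; if the first side of that part were in [AA], its
    spokes would all be present and cover the pair. The factor 2 counts both orders. *)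
Lemma uncovered_pairs_le (AA : {set {set T}}) :
  (#|uncovered_pairs AA U E| <=
   2 * \sum_(F in P | (sides F).1 \notin AA) #|(sides F).1| * #|(sides F).2|)%N.
Proof.
pose X F := setX (sides F).1 (sides F).2 :|: setX (sides F).2 (sides F).1.
apply: (@leq_trans #|\bigcup_(F in P | (sides F).1 \notin AA) X F|).
  apply: subset_leq_card; apply/subsetP => -[x y]; rewrite inE /=.
  move=> /and3P[xU yU /and4P[xy exy unc1 unc2]].
  have : [set x; y] \in induced_edges E U by rewrite inE exy subUset !sub1set xU.
  case/andP: (bipP) => /and3P[/eqP <- _ _] _ /bigcupP[F FP eF].
  have FE := part_sub FP; have FB := part_biclique FP.
  have /and4P[_ /pred0P dis _ _] := sidesP FP.
  have cov a b : a \in (sides F).1 -> b \in (sides F).2 ->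
      side_uncovered AA E a b -> (sides F).1 \notin AA.
    move=> aA bB /forall_inP unc; apply/negP => /unc; rewrite aA /=.
    have := dis b; rewrite /= bB andbT => -> /=; case/negP.
    apply/subsetP => e /imsetP[z]; rewrite !inE => /andP[_ zA] ->.
    have : [set z; b] \in F by rewrite FB; apply/imset2P; exists z b.
    by move=> /(subsetP FE); rewrite inE => /andP[].
  have : [set x; y] \in biclique (sides F) by rewrite -FB.
  case/imset2P => a b aA bB eab.
  have xab : x \in [set a; b] by rewrite -eab set21.
  have yab : y \in [set a; b] by rewrite -eab set22.
  apply/bigcupP; exists F; rewrite /X ?in_setU ?in_setX /=.
    rewrite FP /=; move: xab yab xy; rewrite !inE.
    case/orP=> /eqP xE; case/orP=> /eqP yE; rewrite ?xE ?yE ?eqxx // => _.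
      by apply: cov aA bB _; rewrite -xE -yE.
    by apply: cov aA bB _; rewrite -xE -yE.
  move: xab yab xy; rewrite !inE.
  by case/orP=> /eqP ->; case/orP=> /eqP ->; rewrite ?eqxx // aA bB ?orbT.
apply: (@leq_trans (\sum_(F in P | (sides F).1 \notin AA) #|X F|)%N).
  elim/big_rec2: _ => [|F n B _ IH]; first by rewrite cards0.
  by apply: leq_trans (leq_card_setU _ _).1 _; rewrite leq_add2l.
rewrite big_distrr /=; apply: leq_sum => F _.
apply: leq_trans (leq_card_setU _ _).1 _; rewrite !cardsX; lia.
Qed.

(** The first side is the smaller one, so both sides are below [b]. *)
Lemma light_parts (b : nat) :
  (\sum_(F in P | #|(sides F).2| < b) #|(sides F).1| * #|(sides F).2| <= #|P| * b ^ 2)%N.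
Proof.
apply: (@leq_trans (\sum_(F in P | #|(sides F).2| < b) b ^ 2)%N).
  apply: leq_sum => F /andP[/sidesP /and5P[_ _ _ AB _] Bb].
  by rewrite -mulnn leq_mul // ltnW // (leq_ltn_trans AB).
rewrite big_const iter_addn_0 mulnC leq_mul2r; apply/orP; right.
by apply: subset_leq_card; apply/subsetP => F /andP[].
Qed.

(** Contrapositive: the sides of these parts, edge-disjoint as blocks of a partition, would
    themselves be a large family. *)
Lemma large_parts (L b k G : nat) : (#|P| <= k)%N ->
  ~~ [exists Q, large_family U L b k G E Q] ->
  (\sum_(F in P | (L <= #|(sides F).1|) && (b <= #|(sides F).2|))
     #|(sides F).1| * #|(sides F).2| <= G)%N.
Proof.
move=> Pk; apply: contraNT; rewrite -ltnNge => GS.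
pose PL := [set F in P | (L <= #|(sides F).1|)%N && (b <= #|(sides F).2|)%N].
have PLP F : F \in PL -> F \in P by rewrite inE => /andP[].
have injL : {in PL &, injective sides} by move=> F F' /PLP ? /PLP ?; exact: sides_inj.
apply/existsP; exists (sides @: PL); apply/and5P; split.
- apply/forall_inP => _ /imsetP[F FPL ->]; rewrite /large_pair.
  move: FPL; rewrite inE => /andP[/sidesP/and5P[_ _ _ _ /andP[-> ->]]] /=.
  by [].
- apply/andP; split; apply/forall_inP => _ /imsetP[F /PLP FP ->].
    by case/and5P: (sidesP FP).
  apply/forall_inP => _ /imsetP[F' /PLP F'P ->]; apply/implyP => neq.
  rewrite -!part_biclique //; apply/pred0P => e /=; apply/negP => /andP[eF eF'].
  by case/eqP: neq; rewrite (part_disjoint FP F'P eF eF').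
- apply: leq_trans (leq_imset_card _ _) (leq_trans _ Pk).
  by apply: subset_leq_card; apply/subsetP => F /PLP.
- rewrite /num_edges big_imset //=; apply: leq_trans (ltnW GS) _.
  by rewrite (eq_bigl (mem PL)) // => F; rewrite !inE.
apply/bigcupsP => _ /imsetP[F /PLP FP ->]; rewrite -part_biclique //.
apply: subset_trans (part_sub FP) _; apply/subsetP => e.
by rewrite inE => /andP[].
Qed.

(* Each edge at a vertex of W lies in a single part, so the sides opposite to
   those meeting W have at most |W||U| elements in total. *)
Lemma hub_parts (L : nat) W :
  (\sum_(F in P | (#|(sides F).1| <= L) && ~~ [disjoint (sides F).1 & W])
     #|(sides F).1| * #|(sides F).2| <= L * (#|W| * #|U|))%N.
Proof.
apply: (@leq_trans (\sum_(F in P | ~~ [disjoint (sides F).1 & W]) L * #|(sides F).2|)%N).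
  rewrite [leqRHS](bigID (fun F => #|(sides F).1| <= L)%N) /=.
  apply: leq_trans (leq_addr _ _).
  under eq_bigl do rewrite andbCA andbC -andbA.
  under [leqRHS]eq_bigl do rewrite -andbA.
  by apply: leq_sum => F /and3P[_ _ AL]; rewrite leq_mul2r AL orbT.
rewrite -big_distrr leq_mul2l; apply/orP; right.
apply: (@leq_trans (\sum_(F in P) \sum_(y in U) \sum_(z in W) ([set z; y] \in F))%N).
  rewrite [leqRHS](bigID (fun F => ~~ [disjoint (sides F).1 & W])) /=.
  apply: leq_trans (leq_addr _ _); apply: leq_sum => F /andP[FP].
  have /and5P[_ _ _ _ /andP[_ /subsetP BU]] := sidesP FP.
  move=> /pred0Pn[z /= /andP[zA zW]].
  rewrite [leqRHS](bigID (mem (sides F).2)) /=; apply: leq_trans (leq_addr _ _).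
  rewrite -sum1_card (eq_bigl (fun y => (y \in U) && (y \in (sides F).2))); last first.
    by move=> y /=; case: (boolP (y \in (sides F).2)) => [/BU ->|]; rewrite ?andbF.
  apply: leq_sum => y /andP[_ yB]; rewrite (bigD1 z) //=.
  rewrite {1}(part_biclique FP) (_ : _ \in _) ?leq_addr //.
  by apply/imset2P; exists z y.
rewrite exchange_big /=.
apply: (@leq_trans (\sum_(y in U) #|W|)%N); last by rewrite sum_nat_const mulnC.
apply: leq_sum => y _; rewrite exchange_big /= -sum1_card; apply: leq_sum => z _.
have [/existsP[F /andP[FP eF]]|] := boolP [exists F, (F \in P) && ([set z; y] \in F)].
  rewrite (bigD1 F) //= eF big1 // => F' /andP[F'P]; case: (boolP (_ \in F')) => // eF'.
  by rewrite (part_disjoint F'P FP eF' eF) eqxx.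
rewrite negb_exists => /forallP none; rewrite big1 // => F FP.
by have := none F; rewrite FP /= => /negbTE ->.
Qed.

(** [AA] consists of the first sides of size at most [L] that avoid the vertices of degree above
    [K], and [w] is the number of those vertices. *)
Lemma small_sides_family (L b K k G : nat) : (#|P| <= k)%N ->
  ~~ [exists Q, large_family U L b k G E Q] ->
  exists AA : {set {set T}}, exists w : nat,
    [/\ forall A, A \in AA -> [/\ A \subset U, (2 <= #|A|)%N & (#|A| <= L)%N],
        forall z, (#|[set A in AA | z \in A]| <= K)%N,
        (#|AA| <= k)%N, (w * K <= k * L)%N
      & (#|uncovered_pairs AA U E| <= 2 * (k * b ^ 2 + G + L * (w * #|U|)))%N].
Proof.
move=> Pk noL.
pose AA0 := [set (sides F).1 | F in [set F in P | #|(sides F).1| <= L]]%N.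
have AA0p A : A \in AA0 -> [/\ A \subset U, (2 <= #|A|)%N & (#|A| <= L)%N].
  move=> /imsetP[F]; rewrite inE => /andP[FP AL] ->.
  by have /and5P[_ _ A2 _ /andP[AU _]] := sidesP FP; split.
have AA0k : (#|AA0| <= k)%N.
  apply: leq_trans (leq_imset_card _ _) (leq_trans _ Pk).
  by apply: subset_leq_card; apply/subsetP => F; rewrite inE => /andP[].
pose W := [set z | K < #|[set A in AA0 | z \in A]|]%N.
pose AA := [set A in AA0 | [disjoint A & W]].
have AAsub A : A \in AA -> A \in AA0 by rewrite inE => /andP[].
exists AA, #|W|; split.
- by move=> A /AAsub /AA0p.
- move=> z; have [zW|zW] := boolP (z \in W).
    rewrite (_ : [set _ in _ | _] = set0) ?cards0 //; apply/setP => A; rewrite !inE.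
    apply/negP => /andP[/andP[_ /pred0P/(_ z)]] /= + zA.
    by rewrite zA zW.
  apply: leq_trans (_ : #|[set A in AA0 | z \in A]| <= _)%N.
    by apply: subset_leq_card; apply/subsetP => A; rewrite !inE => /andP[/andP[-> _] ->].
  by move: zW; rewrite inE -leqNgt.
- apply: leq_trans AA0k; apply: subset_leq_card; apply/subsetP => A; exact: AAsub.
(* Double counting of incidences: each vertex of [W] lies in more than [K] members of [AA0], and
   each member has at most [L] vertices. *)
- rewrite -sum_nat_const.
  apply: (@leq_trans (\sum_(z in W) \sum_(A in AA0) (z \in A))%N).
    apply: leq_sum => z; rewrite inE => /ltnW /leq_trans; apply.
    rewrite -sum1_card [leqRHS](bigID (fun A : {set T} => z \in A)) /=.
    apply: leq_trans (leq_addr _ _).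
    rewrite (eq_bigl (fun A => (A \in AA0) && (z \in A))) => [|A]; last by rewrite inE.
    by apply: leq_sum => A /andP[_ ->].
  rewrite exchange_big /=; apply: (@leq_trans (\sum_(A in AA0) L)%N).
    apply: leq_sum => A /AA0p[_ _ AL]; apply: leq_trans AL.
    rewrite -sum1_card big_mkcond [leqRHS]big_mkcond /=; apply: leq_sum => z _.
    by case: (z \in W); case: (z \in A).
  by rewrite sum_nat_const leq_mul2r AA0k orbT.
apply: leq_trans (uncovered_pairs_le AA) _; rewrite leq_mul2l /=.
have Gk := large_parts Pk noL; have Bk := light_parts b; have Hk := hub_parts L W.
have Bk' : (#|P| * b ^ 2 <= k * b ^ 2)%N by rewrite leq_mul2r Pk orbT.
apply: leq_trans (leq_add (leq_add (leq_trans Bk Bk') Gk) Hk).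
(* A part whose first side is not in [AA] has a second side below [b], or two large sides, or a
   small first side meeting [W]. *)
rewrite !big_mkcondr -!big_split /=; apply: leq_sum => F FP.
case: ifP => // nAA; case: ltnP => // bB; rewrite ?leq_addr -?addnA ?leq_addr //.
have [AL|LA] := leqP #|(sides F).1| L; last first.
  by rewrite (ltnW LA) /= add0n leq_addr.
have -> : ~~ [disjoint (sides F).1 & W].
  move: nAA; rewrite inE negb_and => /orP[|//].
  by case/negP; apply/imsetP; exists F; rewrite ?inE ?FP.
by rewrite add0n leq_addl.
Qed.

End Decomposition.

(** * Probability of a short partition *)

Section ShortDecompositions.
Local Open Scope set_scope.

Definition bounded_family (T : finType) (U : {set T}) (K L k : nat)
    (AA : {set {set T}}) : bool :=
  [&& [forall A in AA, [&& A \subset U, (2 <= #|A|)%N & (#|A| <= L)%N]],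
      [forall z, #|[set A in AA | z \in A]| <= K]%N & (#|AA| <= k)%N].

(** There are at most e n^L sets of size at most [L], and at most [k] of them are selected. *)
Lemma card_bounded_family (R : realType) (T : finType) (U : {set T}) (K L k : nat) :
  (0 < #|T|)%N ->
  #|[set AA | bounded_family U K L k AA]|%:R <=
  expR (1 + k%:R * (1 + L%:R * ln #|T|%:R)) :> R.
Proof.
move=> T0; have T0R : 0 < #|T|%:R :> R by rewrite ltr0n.
have T1R : 1 <= #|T|%:R :> R by rewrite ler1n.
pose S := [set A : {set T} | (A \subset [set: T]) && (#|A| <= L)%N].
pose sg : R := expR 1 * #|T|%:R ^+ L.
have Ssg : #|S|%:R <= sg by apply: card_small_subsets; rewrite ?cardsT.
have e1 : 1 <= expR 1 :> R by rewrite -[leLHS]expR0 ler_expR.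
have sg1 : 1 <= sg.
  by rewrite -[leLHS]mulr1; apply: ler_pM => //; rewrite ?exprn_ege1.
have -> : expR (1 + k%:R * (1 + L%:R * ln #|T|%:R)) = expR 1 * sg ^+ k :> R.
  rewrite expRD expRM_natl expRD expRM_natl lnK //.
apply: le_trans (card_small_subsets k sg1 Ssg).
rewrite ler_nat; apply: subset_leq_card; apply/subsetP => AA.
rewrite !inE => /and3P[/forall_inP AAp _ ->]; rewrite andbT.
by apply/subsetP => A /AAp /and3P[_ _ AL]; rewrite inE subsetT.
Qed.

(** A short partition forces a large family or a bounded family leaving few uncovered pairs, and
    both are unlikely. The constants depend on [p] alone, and the bound is small enough for a union
    over all [U]. *)
Lemma short_decomposition_prob (R : realType) (p : R) : 0 < p -> p <= 1 / 2 ->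
  exists2 M : R, 4 <= M & forall (T : finType) (U : {set T}),
    1 <= ln #|T|%:R :> R -> M * ln #|T|%:R <= #|U|%:R ->
    subset_mean p (vertex_pairs [set: T])
      (fun E => [exists P, strong_bipartition (induced_edges E U) P &&
                           (#|P| <= 2 * #|U|)%N]%:R) <=
    2 * (#|T|%:R^-1) ^+ (2 * #|U|).
Proof.
move=> p0 p2; have p1 : p <= 1 by lra.
pose q : R := p * expR (- 16) / 8; pose th : R := - ln p / 4.
have q0 : 0 < q by rewrite divr_gt0 ?mulr_gt0 ?expR_gt0.
have th0 : 0 < th by rewrite divr_gt0 // oppr_gt0 ln_lt0 // p0 /=; lra.
(* A fourth root of p, as in large_family_prob. *)
pose s : R := expR (- th).
have sX k : s ^+ k = expR (- (k%:R * th)) by rewrite /s -expRM_natl mulrN.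
have s4 : s ^+ 4 = p.
  have e4 : - (4 * th) = ln p by rewrite /th; field.
  by rewrite sX e4 lnK.
have s0 : 0 <= s by exact: expR_ge0.
have s1 : s <= 1 by rewrite /s -[leRHS]expR0 ler_expR oppr_le0 ltW.
(* Choosing large pairs then costs at most [4 * del * m ^+ 2] in the exponent, half of what
   [s ^+ (2 * G)] gains up to rounding of [G]. *)
pose del : R := th * q / 48.
have del0 : 0 < del by rewrite divr_gt0 // mulr_gt0.
have [L sL] : exists L : nat, s ^+ L <= del.
  exists (Num.truncn (del^-1 / th)).+1; rewrite sX.
  set x := _ * th; have xd : del^-1 <= x.
    rewrite /x -ler_pdivrMr //; apply: ltW; exact: truncnS_gt.
  rewrite expRN -[del]invrK lef_pV2 ?posrE ?expR_gt0 ?invr_gt0 //.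
  by apply: le_trans xd (le_trans _ (expR_ge1Dx _)); rewrite lerDr.
(* From w K <= 2mL, such a [K] bounds L w m by q m^2 / 12. *)
have [K Kq] : exists K : nat, 24 * L%:R ^+ 2 / q <= K%:R.
  by exists (Num.truncn (24 * L%:R ^+ 2 / q)).+1; apply/ltW/truncnS_gt.
pose c : R := (8 * (K * L).+1)%:R.
have c0 : 0 < c by rewrite ltr0n.
pose ka : R := q ^+ 2 / (32 * c ^+ 2).
have ka0 : 0 < ka by rewrite divr_gt0 ?mulr_gt0 ?exprn_gt0.
(* [M1], [M2], [M3] serve [num1], [num2], [num3]: the large families, the number of choices of [AA],
   and the parts with both sides below [L]. *)
pose M1 : R := (3 + 2 * th) * 12 / (th * q).
pose M2 : R := (5 + 2 * L%:R) / ka.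
pose M3 : R := 24 * L%:R ^+ 2 / q.
have M10 : 0 <= M1.
  apply: divr_ge0; last exact: ltW (mulr_gt0 th0 q0).
  by apply: mulr_ge0 => //; lra.
have M20 : 0 <= M2.
  by apply: divr_ge0; [rewrite addr_ge0 ?mulr_ge0|exact: ltW].
have M30 : 0 <= M3 by rewrite divr_ge0 ?mulr_ge0 ?exprn_ge0 // ltW.
exists (4 + M1 + M2 + M3) => [|T U]; first lra.
set l := ln _; set m := #|U|%:R; move=> l1 mM.
have l0 : 0 < l by lra.
have T0 : (0 < #|T|)%N.
  by rewrite lt0n; apply: contraTneq l1 => T0; rewrite /l T0 ln0 // -ltNge ltr01.
have [m4 [mM1 [mM2 mM3]]] : 4 <= m /\ (M1 * l <= m /\ (M2 * l <= m /\ M3 <= m)).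
  have := mulr_ge0 M10 (ltW l0); have := mulr_ge0 M20 (ltW l0).
  have : 0 <= M3 * (l - 1) by apply: mulr_ge0 => //; lra.
  by move: mM; rewrite !mulrDl => *; do !split; lra.
have U4 : (4 <= #|U|)%N by rewrite -(ler_nat R).
have lm : 4 <= l * m.
  by rewrite -[leLHS]mul1r; apply: ler_pM; rewrite ?ler01 //; lra.
have num1 : 1 + 2 * th + 2 * (m * l) <= th * q / 12 * m ^+ 2.
  have : (3 + 2 * th) * l <= th * q / 12 * m.
    have h : 0 <= th * q / 12 by apply: divr_ge0 => //; exact: ltW (mulr_gt0 th0 q0).
    have := ler_wpM2l h mM1; rewrite /M1; apply: le_trans.
    rewrite le_eqVlt; apply/orP; left; apply/eqP; field.
    by rewrite !gt_eqF.
  have m0 : 0 <= m by lra.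
  move=> /(ler_wpM2r m0); have := mulr_ge0 (ltW th0) (_ : 0 <= l * m - 1).
  rewrite subr_ge0 => /(_ (le_trans _ lm)); lra.
have num2 : 1 + 2 * m * (1 + L%:R * l) + 2 * (m * l) <= ka * m ^+ 2.
  have : (5 + 2 * L%:R) * l <= ka * m.
    have := ler_wpM2l (ltW ka0) mM2; rewrite /M2; apply: le_trans.
    rewrite le_eqVlt; apply/orP; left; apply/eqP; field.
    by rewrite !gt_eqF.
  have m0 : 0 <= m by lra.
  move=> /(ler_wpM2r m0); have : 0 <= m * (l - 1) by apply: mulr_ge0; lra.
  by move: (L%:R) => L'; lra.
have num3 : 2 * m * L%:R ^+ 2 <= q / 12 * m ^+ 2.
  have : 2 * L%:R ^+ 2 <= q / 12 * m.
    have h : 0 <= q / 12 by apply: divr_ge0 => //; exact: ltW.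
    have := ler_wpM2l h mM3; rewrite /M3; apply: le_trans.
    rewrite le_eqVlt; apply/orP; left; apply/eqP; field.
    by rewrite !gt_eqF.
  have m0 : 0 <= m by lra.
  by move=> /(ler_wpM2r m0); move: (L%:R) => L'; lra.
pose G := Num.truncn (q / 12 * m ^+ 2).
have qm0 : 0 <= q / 12 * m ^+ 2 by rewrite mulr_ge0 ?sqr_ge0 // divr_ge0 // ltW.
have /andP[Gle Ggt] := truncn_itv qm0; rewrite -/G in Gle Ggt.
have nU : (#|T|%:R^-1) ^+ (2 * #|U|) = expR (- (2 * (m * l))) :> R.
  rewrite -[X in X^-1](@lnK R) ?posrE ?ltr0n // -/l -expRN -expRM_natl natrM.
  by congr expR; rewrite -/m; ring.
pose k := (2 * #|U|)%N; have km : k%:R = 2 * m :> R by rewrite natrM.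
set D := vertex_pairs _.
pose low AA E : bool := #|uncovered_pairs AA U E|%:R <= q / 2 * m ^+ 2.
(* Without a large family, each of the three kinds of parts outside [AA] has at most
   [q / 12 * m ^+ 2] edges in total; doubling the sum gives the threshold in [low]. *)
have cover E : [exists P, strong_bipartition (induced_edges E U) P && (#|P| <= k)%N] ->
  [exists Q, large_family U L L k G E Q] ||
  [exists AA in [set AA | bounded_family U K L k AA], low AA E].
  move=> /existsP[P /andP[bip Pk]]; case: (boolP [exists Q, _]) => //= noL.
  have [AA [w [AAp degK AAk wK unc]]] := small_sides_family bip K Pk noL.
  apply/existsP; exists AA; rewrite inE; apply/andP; split.
    apply/and3P; split => //.
      by apply/forall_inP => A /AAp[-> -> ->].
    exact/forallP.
  rewrite /low; move: unc; rewrite -(ler_nat R) => /le_trans; apply.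
  rewrite natrM !natrD !natrM -/m.
  have wK' : w%:R * K%:R <= 2 * m * L%:R :> R by rewrite -km -!natrM ler_nat.
  have hw : L%:R * (w%:R * m) <= q / 12 * m ^+ 2.
    have w0 : 0 <= w%:R :> R by [].
    have h1 := ler_wpM2l w0 Kq; have {h1} := le_trans h1 wK'.
    rewrite (mulrA w%:R _ q^-1) ler_pdivrMr // => h1.
    have [->|L0] := eqVneq L 0%N; first by rewrite mul0r.
    have Lp : 0 < L%:R :> R by rewrite ltr0n lt0n.
    have : 24 * (L%:R * w%:R) <= 2 * m * q.
      rewrite -(ler_pM2r Lp); move: h1; rewrite expr2.
      by move: (L%:R) (w%:R) => L' w'; lra.
    have m0 : 0 <= m by lra.
    by move=> /(ler_wpM2r m0); move: (L%:R) (w%:R) => L' w'; lra.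
  by move: Gle hw num3; move: (L%:R) (w%:R) (G%:R) => L' w' G'; lra.
have mean_large : subset_mean p D
    (fun E => [exists Q, large_family U L L k G E Q]%:R) <= expR (- (2 * (m * l))).
  rewrite -s4; apply: le_trans (large_family_prob _ _ _ _ _ s0 s1) _.
  rewrite sX -expRD ler_expR !natrM -/m.
  have h : 0 <= m ^+ 2 by exact: sqr_ge0.
  have := ler_wpM2l h sL; rewrite /del.
  have GS : G.+1%:R = G%:R + 1 :> R by rewrite -natr1.
  have := ler_wpM2l (ltW th0) (ltW Ggt); rewrite GS.
  by move: (s ^+ L) (G%:R) => x y; lra.
have mean_low AA : bounded_family U K L k AA ->
    subset_mean p D (fun E => (low AA E)%:R) <= expR (- ka * m ^+ 2).
  move=> /and3P[/forall_inP AAp /forallP degK AAk].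
  by apply: uncovered_tail => //; [exact: ltW|move=> A /AAp/and3P[]].
apply: (@le_trans _ _ (subset_mean p D (fun E =>
   [exists Q, large_family U L L k G E Q]%:R +
   \sum_(AA | bounded_family U K L k AA) (low AA E)%:R))).
  apply: le_subset_mean => //; first exact: ltW.
  move=> E _; case: (boolP [exists P, _]) => [/cover|_]; last first.
    by apply: addr_ge0 => //; apply: sumr_ge0.
  case/orP=> [->|/exists_inP[AA]].
    by rewrite -[leLHS]addr0 lerD2l; apply: sumr_ge0.
  rewrite inE => bAA lowE; rewrite (bigD1 AA) //= lowE addrCA -[leLHS]addr0 lerD2l.
  by apply: addr_ge0 => //; apply: sumr_ge0.
rewrite subset_meanD subset_mean_sum nU mulrDl mul1r; apply: lerD => //.
apply: (@le_trans _ _ (\sum_(AA | bounded_family U K L k AA) expR (- ka * m ^+ 2))).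
  by apply: ler_sum => AA; exact: mean_low.
have := card_bounded_family R U K L k T0; rewrite cardsE => cardF.
rewrite sumr_const -[leLHS]mulr_natl; apply: le_trans (ler_wpM2r (expR_ge0 _) cardF) _.
by rewrite -expRD ler_expR km -/l; lra.
Qed.

End ShortDecompositions.

(** * Union bound over vertex subsets in G(n, p) *)

Section RandomGraph.
Variable R : realType.

Lemma Gnp_probE (n : nat) (p : R) (A : pred {set {set 'I_n}}) :
  Gnp_prob p A = subset_mean p (vertex_pairs [set: 'I_n]%SET) (fun E => (A E)%:R).
Proof.
rewrite /Gnp_prob /subset_mean [RHS](bigID A) /= [X in _ + X]big1 ?addr0.
  by apply: eq_bigr => E /andP[_ ->]; rewrite mulr1.
by move=> E /andP[_ /negbTE ->]; rewrite mulr0.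
Qed.

(** Every partition has more than [2 * #|U|] parts, well above 1.0001 times [#|U|]; [2 < #|U|]
    excludes the case where [tau'] is 0 by convention. *)
Lemma tau'_ge (T : finType) (U : {set T}) (E : {set {set T}}) : (2 < #|U|)%N ->
  ~~ [exists P, strong_bipartition (induced_edges E U) P && (#|P| <= 2 * #|U|)%N] ->
  ((10001 / 10000 * #|U|%:R)%:E <= tau' R U (induced_edges E U))%E.
Proof.
move=> U2 noP; rewrite /tau' leqNgt U2 /=; apply/ereal_infP => _ [P bip <-].
rewrite lee_fin; have : (2 * #|U| <= #|P|)%N.
  apply: ltnW; rewrite ltnNge; apply: contra noP => P2.
  by apply/existsP; exists P; rewrite P2 andbT.
rewrite -(ler_nat R) natrM; have : 0 <= #|U|%:R :> R by [].
by move: (#|U|%:R) (#|P|%:R) => u v; lra.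
Qed.

(** With x = log_b n >= 1, the power is at least x^2, and c x^2 >= M x ln b as soon as x >= M ln b /
    c; [X] forces both. *)
Lemma dense_threshold (b c eps M : R) : 1 < b -> 0 < c -> 0 < eps -> 0 <= M ->
  exists N : nat, forall n : nat, (N <= n)%N ->
    1 <= ln n%:R :> R /\
    M * ln n%:R <= c * (logb b n%:R) `^ (3 + eps).
Proof.
move=> b1 c0 eps0 M0; have lb0 : 0 < ln b by rewrite ln_gt0.
pose X := 1 + ln b * (1 + M * ln b / c).
exists (Num.truncn (expR X)).+1 => n Nn.
have Xn : X <= ln n%:R.
  have h : expR X <= n%:R.
    by apply: le_trans (ltW (truncnS_gt _)) _; rewrite ler_nat.
  have n0 : 0 < n%:R :> R by apply: lt_le_trans h; exact: expR_gt0.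
  by rewrite -ler_expR lnK.
have Mb0 : 0 <= M * ln b / c.
  by apply: divr_ge0 (ltW c0); apply: mulr_ge0 (ltW lb0).
split.
  apply: le_trans Xn; rewrite /X lerDl; apply: mulr_ge0 (ltW lb0) _; lra.
rewrite /logb; set x := ln n%:R / ln b.
have xX : 1 + M * ln b / c <= x.
  by rewrite ler_pdivlMr //; move: Xn; rewrite /X; lra.
have lnx : ln n%:R = x * ln b by rewrite divfK // gt_eqF.
have x1 : 1 <= x by lra.
have x0 : 0 <= x by lra.
apply: (@le_trans _ _ (c * x ^+ 2)); last first.
  apply: ler_wpM2l; first exact: ltW.
  by rewrite -powR_mulrn // ler_powR //; lra.
have : M * ln b <= c * x.
  by rewrite -ler_pdivrMl // mulrC; lra.
by move=> /(ler_wpM2r x0); rewrite lnx; lra.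
Qed.

(** Union bound: the sum of n^(-|U|) over all [U] is (1 + 1/n)^n, at most e, and a further factor
    1/n remains. *)
Lemma Gnp_prob_near1 (n : nat) (p : R) (big : pred {set 'I_n})
    (A : pred {set {set 'I_n}}) : (0 < n)%N -> 0 <= p -> p <= 1 ->
  (forall U, big U -> (0 < #|U|)%N /\
     subset_mean p (vertex_pairs [set: 'I_n]%SET)
       (fun E => [exists P, strong_bipartition (induced_edges E U) P &&
                            (#|P| <= 2 * #|U|)%N]%:R) <=
     2 * (n%:R^-1) ^+ (2 * #|U|)) ->
  (forall E, ~~ A E -> exists2 U, big U &
     [exists P, strong_bipartition (induced_edges E U) P &&
                (#|P| <= 2 * #|U|)%N]) ->
  1 - 4 * expR 1 * harmonic n <= Gnp_prob p A <= 1.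
Proof.
move=> n0 p0 p1 bigP badA; rewrite Gnp_probE; set D := vertex_pairs _.
have n0R : 0 < n%:R :> R by rewrite ltr0n.
apply/andP; split; last first.
  rewrite -[leRHS](subset_mean_cst p D 1); apply: le_subset_mean => // E _.
  by case: (A E).
pose bad (U : {set 'I_n}) E := [exists P, strong_bipartition (induced_edges E U) P &&
                 (#|P| <= 2 * #|U|)%N].
rewrite lerBlDr -[leLHS](subset_mean_cst p D 1).
apply: (@le_trans _ _ (subset_mean p D
  (fun E => (A E)%:R + \sum_(U | big U) (bad U E)%:R))).
  apply: le_subset_mean => // E _; case: (boolP (A E)) => [_|/badA[U bU badU]].
    by rewrite lerDl; apply: sumr_ge0.
  by rewrite add0r (bigD1 U) //= /bad badU lerDl; apply: sumr_ge0.
rewrite subset_meanD subset_mean_sum lerD2l.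
apply: (@le_trans _ _ (\sum_(U : {set 'I_n}) 2 * n%:R^-1 * n%:R^-1 ^+ #|U|)).
  rewrite [leRHS](bigID big) /= -[leLHS]addr0; apply: lerD; last first.
    apply: sumr_ge0 => U _; apply: mulr_ge0; last by rewrite exprn_ge0 // invr_ge0.
    by rewrite mulr_ge0 // invr_ge0.
  apply: ler_sum => U /bigP[U0 /le_trans]; apply.
  rewrite -mulrA; apply: ler_wpM2l => //; rewrite -exprS.
  (* Since [U] is nonempty, [2 * #|U|] is at least [#|U|.+1]; this spares the factor 1/n. *)
  apply: ler_wiXn2l; rewrite ?invr_ge0 ?invf_le1 ?ler1n //.
  by rewrite mul2n -addnn -addn1 leq_add2l.
rewrite -mulr_sumr.
have sumU : \sum_(U : {set 'I_n}) n%:R^-1 ^+ #|U| <= expR 1 :> R.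
  rewrite (eq_bigl (fun U : {set 'I_n} => U \subset [set: 'I_n]%SET)); last first.
    by move=> U; rewrite subsetT.
  rewrite (eq_bigr (fun U : {set 'I_n} => \prod_(x in U) n%:R^-1)); last first.
    by move=> U _; rewrite prodr_const.
  rewrite sum_prod_subset; apply: le_trans (prod1D_le_expR _ _) _.
    by move=> _; rewrite invr_ge0.
  by rewrite sumr_const cardsT card_ord -[_ *+ n]mulr_natr mulVf // gt_eqF.
(* [harmonic n] is 1/(n + 1), so 2e/n becomes 4e/(n + 1). *)
have nV : n%:R^-1 <= 2 * n.+1%:R^-1 :> R.
  rewrite -[leLHS]mul1r ler_pdivrMr // mulrAC ler_pdivlMr ?ltr0n // mul1r.
  by rewrite -natrM ler_nat; lia.
have h0 : 0 <= n%:R^-1 :> R by rewrite invr_ge0.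
have e0 := expR_ge0 (1 : R).
apply: le_trans (ler_wpM2l (mulr_ge0 _ h0) sumU) _ => //.
move: (ler_wpM2r e0 nV); rewrite /harmonic /=.
by move: (expR 1) (n%:R^-1) (n.+1%:R^-1) => x y z; lra.
Qed.

End RandomGraph.

Theorem theorem6 (R : realType) (p b c eps : R)
    (hp0 : 0 < p) (hp : p <= 1 / 2) (hb : b = 1 / p)
    (hc : 0 < c) (heps : 0 < eps) :
  aas p (fun (n : nat) (E : {set {set 'I_n}}) =>
    [forall U : {set 'I_n},
       (c * (logb b n%:R) `^ (3 + eps) <= #|U|%:R) ==>
       ((10001 / 10000 * #|U|%:R)%:E <= tau' R U (induced_edges E U))%E]).
Proof.
have hp1 : p <= 1 by lra.
have b1 : 1 < b by rewrite hb ltr_pdivlMr // mul1r; lra.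
have [M M4 short] := short_decomposition_prob hp0 hp.
have M0 : 0 <= M by lra.
have [N NP] := dense_threshold b1 hc heps M0.
rewrite /aas; set A := fun n => _.
(* The probability lies between 1 - 4e/(n + 1) and 1 for large n. *)
apply: (@squeeze_cvgr _ _ _ _ (fun n => 1 - 4 * expR 1 * harmonic n) (fun=> 1)).
- near=> n.
  have Nn : (N <= n)%N by near: n; exact: nbhs_infty_ge.
  have n0 : (0 < n)%N by near: n; exact: nbhs_infty_gt.
  have [ln1 thr] := NP n Nn.
  pose big (U : {set 'I_n}) : bool := c * logb b n%:R `^ (3 + eps) <= #|U|%:R.
  have bigM U : big U -> M * ln n%:R <= #|U|%:R by apply: le_trans.
  have big4 U : big U -> (4 <= #|U|)%N.
    move=> /bigM h; rewrite -(ler_nat R); apply: le_trans h; nra.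
  apply: (@Gnp_prob_near1 _ _ _ big) => //; first exact: ltW.
    move=> U bU; split; first by apply: leq_trans (big4 _ bU).
    by have := short _ U; rewrite card_ord; apply => //; exact: bigM.
  move=> E; rewrite negb_forall => /existsP[U]; rewrite negb_imply => /andP[bU ntau].
  exists U => //; apply: contraR ntau => noP; apply: tau'_ge noP.
  by apply: leq_trans (big4 _ bU).
- have lim : ((1 - 4 * expR 1 * harmonic n : R) @[n --> \oo] -->
              (1 - 4 * expR 1 * 0 : R))%classic.
    apply: cvgB; first exact: cvg_cst.
    apply: cvgM; first exact: cvg_cst.
    exact: cvg_harmonic.
  by rewrite mulr0 subr0 in lim.
- exact: cvg_cst.
Unshelve. all: by end_near. Qed.
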